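(* Let $p>n$, $\kappa\in\mathbb F_p^\times$, and $0<d(\kappa)<n-1$. Let $f(z)$ be a $V$-valued rational function in $z=(z_1,\dots,z_n)$ over $\mathbb K$ which is a solution of the qKZ equations with step $\kappa$. Then $f(z)$ is a linear combination of the $p$-hypergeometric solutions $Q^{\ell p-1}(z;\kappa)$, $\ell=1,\dots,d(\kappa)$, with coefficients which are scalar rational functions in $z_i^p-z_i$, $i=1,\dots,n$.
   Context: $\mathbb K$ is a field of characteristic $p$ (prime), $\mathbb F_p\subset\mathbb K$ its prime subfield, $n>1$ an integer, $z=(z_1,\dots,z_n)$. $L$ is the $2$-dimensional $\mathbb K$-vector space with basis $v_1,v_2$. Let $P$ be the permutation of tensor factors of $L^{\otimes 2}$, $R(u)=\frac{u-P}{u-1}$, and let $R^{(i,j)}(u)$ be $R(u)$ acting in the $i$-th and $j$-th factors of $L^{\otimes n}$. For $\kappa\in\mathbb K^\times$, $$K_a(z;\kappa)=R^{(a,a-1)}(z_a-z_{a-1}-\kappa)\cdots R^{(a,1)}(z_a-z_1-\kappa)\,R^{(a,n)}(z_a-z_n)\cdots R^{(a,a+1)}(z_a-z_{a+1}).$$ The qKZ equations with step $\kappa$ are $f(z_1,\dots,z_a-\kappa,\dots,z_n)=K_a(z;\kappa)f(z)$, $a=1,\dots,n$. Let $v^{(i)}=v_1\otimes\cdots\otimes v_2\otimes\cdots\otimes v_1$ ($v_2$ only at the $i$-th place). The span of the $v^{(i)}$ is identified with $\mathbb K^n$, and $V=\{x\in\mathbb K^n\mid x_1+\dots+x_n=0\}$.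 The operators $K_a(z;\kappa)$ preserve $V$. $p$-hypergeometric solutions. For $m\ge 0$ put $(t;\kappa)_m=\prod_{i=1}^m(t-(i-1)\kappa)$. For $\kappa\in\mathbb F_p^\times$ let $k$ be the integer with $0<k<p$ and $\kappa k\equiv-1\pmod p$, and $d(\kappa)=\left[\frac{kn}{p}\right]$ (integer part). Put $$\Phi(t,z;\kappa)=\prod_{a=1}^n(t-z_a;\kappa)_k,\quad \eta_a(t,z)=\frac1{t-z_a}\prod_{j=1}^{a-1}\frac{t-z_j+1}{t-z_j},\quad Q_a(t,z;\kappa)=\Phi(t,z;\kappa)\eta_a(t,z);$$ the $Q_a$ are polynomials in $t,z$. Write $Q(t,z;\kappa)=(Q_1,\dots,Q_n)^\intercal=\sum_i Q^i(z;\kappa)\,(t;\kappa)_i$ with $Q^i(z;\kappa)$ vectors of polynomials in $z$. It is known that each $Q^{\ell p-1}(z;\kappa)$, $\ell\geq 1$, is a $V$-valued solution of the qKZ equations with step $\kappa$; those with $\ell=1,\dots,d(\kappa)$ are called the $p$-hypergeometric solutions. *)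

(* Defs.v *)
From HB Require Import structures.
From mathcomp Require Import all_boot all_order all_algebra.
From mathcomp Require Import generic_quotient perm mpoly.

Set Implicit Arguments.
Unset Strict Implicit.
Unset Printing Implicit Defensive.

Import GRing.Theory.
Local Open Scope ring_scope.

Notation "x %:F" := (FracField.tofrac x) : ring_scope.
Notation ratfun K n := {fraction {mpoly K[n]}}.

(* In a field of prime characteristic p this is F_p. *)
Definition prime_subfield (K : fieldType) (x : K) : Prop :=
  exists m : int, x = m%:~R.

Section RationalFunctions.
Variables (K : fieldType) (n : nat).
Implicit Types (h : n.-tuple {mpoly K[n]}) (x : ratfun K n).

(* Substitution z_i := h_i, meant for algebraically independent h_i: then the
   denominator does not become 0 and any fraction representing x can be used
   (see ratsubstE). *)
Definition ratsubst h x : ratfun K n :=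
  (\n_(repr x)%qT \mPo h)%:F / (\d_(repr x)%qT \mPo h)%:F.

Lemma ratsubstE h (a b : {mpoly K[n]}) :
  injective (comp_mpoly h) -> b != 0 ->
  ratsubst h (a%:F / b%:F) = (a \mPo h)%:F / (b \mPo h)%:F.
Proof.
move=> hI b0; have ch0 c : c != 0 -> (c \mPo h)%:F != 0.
  by apply: contra_neq => /eqP; rewrite tofrac_eq0 => /eqP E; apply: hI;
     rewrite E comp_mpoly0.
rewrite /ratsubst; set r := repr _; have d0 : \d_r != 0 by exact: denom_ratioP.
apply/eqP; rewrite eqr_div ?ch0 // -!rmorphM /= tofrac_eq.
suff -> : \n_r * b = a * \d_r by [].
apply/eqP; rewrite -tofrac_eq !rmorphM /=.
have : (\n_r)%:F / (\d_r)%:F = a%:F / b%:F.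
  rewrite -[RHS]reprK -/r; apply: (@mulIf _ (\d_r)%:F); first by rewrite tofrac_eq0.
  rewrite divfK ?tofrac_eq0 //; unlock FracField.tofrac.
  rewrite -[RHS]FracField.pi_mul; apply/eqmodP => /=.
  rewrite FracField.equivfE /FracField.mulf.
  by rewrite !numden_Ratio ?mulf_neq0 ?oner_neq0 // !mulr1 mul1r mulrC.
by move/eqP; rewrite eqr_div ?tofrac_eq0.
Qed.

Definition shift_tuple (a : 'I_n) (kappa : K) : n.-tuple {mpoly K[n]} :=
  [tuple 'X_i - (if i == a then kappa%:MP else 0) | i < n].

Definition shift (a : 'I_n) (kappa : K) : ratfun K n -> ratfun K n :=
  ratsubst (shift_tuple a kappa).

Lemma shift_tuple_inj a kappa : injective (comp_mpoly (shift_tuple a kappa)).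
Proof.
apply: (can_inj (g := comp_mpoly (shift_tuple a (- kappa)))) => q.
rewrite -[RHS]comp_mpoly_id [RHS]comp_mpolyE [X in X \mPo _]comp_mpolyE.
rewrite raddf_sum /=; apply: eq_bigr => m _; rewrite comp_mpolyZ rmorph_prod /=; congr (_ *: _).
apply: eq_bigr => i _; rewrite rmorphXn /= !tnth_mktuple comp_mpolyB.
rewrite comp_mpolyXU -tnth_nth tnth_mktuple; case: ifP => _.
  by rewrite comp_mpolyC mpolyCN opprK addrK.
by rewrite comp_mpoly0 !subr0.
Qed.

Lemma shiftE a kappa (u v : {mpoly K[n]}) : v != 0 ->
  shift a kappa (u%:F / v%:F) =
  (u \mPo shift_tuple a kappa)%:F / (v \mPo shift_tuple a kappa)%:F.
Proof. exact: ratsubstE (@shift_tuple_inj a kappa). Qed.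

Definition rational_in h (c : ratfun K n) : Prop :=
  exists u v : {mpoly K[n]},
    v \mPo h != 0 /\ c = (u \mPo h)%:F / (v \mPo h)%:F.

Definition artin_schreier_tuple (p : nat) : n.-tuple {mpoly K[n]} :=
  [tuple 'X_i ^+ p - 'X_i | i < n].

End RationalFunctions.

(* L^(x)n with scalars extended to K(z): coordinates in the basis of the
   v_(s 1) (x) ... (x) v_(s n), where false stands for v_1 and true for v_2 *)
Notation tensors K n := {ffun {ffun 'I_n -> bool} -> (ratfun K n)^o}.

Section QKZ.
Variables (K : fieldType) (n : nat).
Local Notation F := (ratfun K n).
Local Notation T := (tensors K n).

Definition permP (i j : 'I_n) (x : T) : T :=
  [ffun s : {ffun 'I_n -> bool} => x [ffun l => s (tperm i j l)]].

Definition Rmat (i j : 'I_n) (u : F) (x : T) : T :=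
  (u - 1)^-1 *: (u *: x - permP i j x).

Definition zvar (i : 'I_n) : F := ('X_i)%:F.

(* a-1, ..., 1, n, ..., a+1: the second indices of the factors of K_a, read
   from left to right *)
Definition Kindices (a : 'I_n) : seq 'I_n :=
  rev [seq j : 'I_n <- enum 'I_n | (j < a)%N] ++
  rev [seq j : 'I_n <- enum 'I_n | (a < j)%N].

Definition Kop (a : 'I_n) (kappa : K) (x : T) : T :=
  foldr (fun j => Rmat a j
           (zvar a - zvar j - (if (j < a)%N then (kappa%:MP)%:F else 0)))
        x (Kindices a).

Definition vexc (i : 'I_n) : T := [ffun s => (s == [ffun l => l == i])%:R].

Definition embed (f : 'cV[F]_n) : T := \sum_i f i 0 *: vexc i.

Definition V_valued (f : 'cV[F]_n) : Prop := \sum_i f i 0 = 0.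

Definition qKZ_solution (kappa : K) (f : 'cV[F]_n) : Prop :=
  forall a : 'I_n, embed (map_mx (shift a kappa) f) = Kop a kappa (embed f).

End QKZ.

(* (t; kappa)_m, with factors t - (i - 1) kappa for i = 1, ..., m *)
Definition poch (A : comNzRingType) (t kappa : A) (m : nat) : A :=
  \prod_(1 <= i < m.+1) (t - kappa *+ i.-1).

Lemma pochS (A : comNzRingType) (t kappa : A) m :
  poch t kappa m.+1 = poch t kappa m * (t - kappa *+ m).
Proof. by rewrite /poch big_nat_recr. Qed.

Lemma poch_recl (A : comNzRingType) (t kappa : A) m :
  poch t kappa m.+1 = t * poch (t - kappa) kappa m.
Proof.
rewrite /poch big_nat_recl //= mulr0n subr0; congr (_ * _).
by rewrite big_add1 big_add1 /=; apply: eq_bigr => i _; rewrite mulrS opprD addrA.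
Qed.

Lemma rmorph_poch (A B : comNzRingType) (g : {rmorphism A -> B}) t kappa m :
  g (poch t kappa m) = poch (g t) (g kappa) m.
Proof. by rewrite rmorph_prod; apply: eq_bigr => i _; rewrite rmorphB rmorphMn. Qed.

(* prod_b (u_b; kappa)_k / u_a * prod_(j < a) (u_j + 1) / u_j, without
   division *)
Definition poch_quot (A : comNzRingType) n (u : 'I_n -> A) (kappa : A) (k : nat)
    (a : 'I_n) : A :=
  \prod_(j < n) (if (j < a)%N then (u j + 1) * poch (u j - kappa) kappa k.-1
           else if j == a then poch (u j - kappa) kappa k.-1
           else poch (u j) kappa k).

Lemma rmorph_poch_quot (A B : comNzRingType) (g : {rmorphism A -> B}) n
    (u : 'I_n -> A) kappa k a :
  g (poch_quot u kappa k a) = poch_quot (g \o u) (g kappa) k a.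
Proof.
rewrite rmorph_prod; apply: eq_bigr => j _ /=.
by case: ifP => _; [|case: ifP => _];
   rewrite ?rmorphM !rmorph_poch ?rmorphB ?rmorphD ?rmorph1.
Qed.

Lemma poch_quotE (E : fieldType) n (u : 'I_n -> E) (kappa : E) k a :
  (0 < k)%N -> (forall j, u j != 0) ->
  (\prod_b poch (u b) kappa k) *
    ((u a)^-1 * \prod_(j < n | (j < a)%N) ((u j + 1) / u j)) =
  poch_quot u kappa k a.
Proof.
move=> k_gt0 u0.
have pF j : poch (u j) kappa k = u j * poch (u j - kappa) kappa k.-1.
  by rewrite -poch_recl prednK.
have -> : (u a)^-1 = \prod_j (if j == a then (u j)^-1 else 1).
  by rewrite -big_mkcond big_pred1_eq.
rewrite [X in _ * (_ * X)]big_mkcond -!big_split /=.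
apply: eq_bigr => j _; case: ltngtP => [ja|aj|ja].
- have -> : (j == a) = false by rewrite -val_eqE /= ltn_eqF.
  by rewrite mul1r pF mulrC mulrA divfK.
- have -> : (j == a) = false by rewrite -val_eqE /= gtn_eqF.
  by rewrite !mulr1.
- by rewrite (val_inj ja) eqxx mulr1 pF mulrAC divff ?mul1r.
Qed.

Section PochhammerBasis.
Variables (A : comNzRingType) (kappa : A).
Local Notation e i := (poch 'X kappa%:P i).

Lemma size_poch i : size (e i) = i.+1.
Proof.
rewrite /poch (eq_bigr (fun j : nat => 'X - (kappa *+ j.-1)%:P)); last first.
  by move=> j _; rewrite polyCMn.
by rewrite size_prod_XsubC size_iota subn1.
Qed.

Lemma monic_poch i : e i \is monic.
Proof.
rewrite /poch (eq_bigr (fun j : nat => 'X - (kappa *+ j.-1)%:P)); last first.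
  by move=> j _; rewrite polyCMn.
exact: monic_prod_XsubC.
Qed.

Lemma poch_basis (q : {poly A}) N : (size q <= N)%N ->
  {c : nat -> A | q = \sum_(i < N) (c i)%:P * e i}.
Proof.
elim: N q => [|N IH] q hq.
  by exists (fun=> 0); rewrite big_ord0; apply/eqP; rewrite -size_poly_leq0.
have [|c hc] := IH (q - (q`_N)%:P * e N).
  apply/leq_sizeP => j; rewrite leq_eqVlt => /predU1P[<-|hj].
    have := monic_poch N; rewrite monicE lead_coefE size_poch => /eqP /= eN.
    by rewrite coefB coefCM eN mulr1 subrr.
  rewrite coefB coefCM (leq_sizeP _ _ hq j hj) [X in _ * X]nth_default ?size_poch //.
  by rewrite mulr0 subr0.
exists (fun i => if i == N then q`_N else c i).
rewrite big_ord_recr /= eqxx; apply/eqP; rewrite -subr_eq {}hc.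
by apply/eqP/eq_bigr => i _; rewrite (ltn_eqF (ltn_ord i)).
Qed.

Lemma poch_free N (c : nat -> A) :
  \sum_(i < N) (c i)%:P * e i = 0 -> forall i, (i < N)%N -> c i = 0.
Proof.
elim: N => [//|N IH] /[dup] E; rewrite big_ord_recr /= => E'.
have cN : c N = 0.
  move/(congr1 (fun q : {poly A} => q`_N)): E'.
  have := monic_poch N; rewrite monicE lead_coefE size_poch => /eqP /= eN.
  rewrite coefD coefCM eN mulr1 coef0 coef_sum big1 ?add0r // => i _.
  by rewrite coefCM nth_default ?mulr0 ?size_poch.
rewrite cN mul0r addr0 in E' => i; rewrite ltnS leq_eqVlt.
by move=> /predU1P[->//|]; apply: IH.
Qed.

Lemma poch_inj N N' (c c' : nat -> A) :
  (forall i, (N <= i)%N -> c i = 0) -> (forall i, (N' <= i)%N -> c' i = 0) ->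
  \sum_(i < N) (c i)%:P * e i = \sum_(i < N') (c' i)%:P * e i -> c =1 c'.
Proof.
move=> c0 c'0; pose M := maxn N N'.
have ext (d : nat -> A) m : (m <= M)%N -> (forall i, (m <= i)%N -> d i = 0) ->
    \sum_(i < m) (d i)%:P * e i = \sum_(i < M) (d i)%:P * e i.
  move=> mM d0; rewrite (big_ord_widen M (fun i => (d i)%:P * e i)) // big_mkcond.
  apply: eq_bigr => j _; case: ifP => [//|]; rewrite ltnNge => /negbFE /d0 ->.
  by rewrite mul0r.
rewrite (ext c N) ?leq_maxl // (ext c' N') ?leq_maxr // => E i.
case: (ltnP i M) => [iM|]; last by rewrite geq_max => /andP[/c0 -> /c'0 ->].
apply/eqP; rewrite -subr_eq0; apply/eqP.
apply: (@poch_free M (fun i => c i - c' i)) => //.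
under eq_bigr do rewrite polyCB mulrBl.
by rewrite sumrB E subrr.
Qed.

End PochhammerBasis.

Section Hypergeometric.
Variables (K : fieldType) (n : nat) (kappa : K) (k : nat).
Local Notation P := {mpoly K[n]}.
(* K(t, z), as the field of fractions of K[z][t] *)
Local Notation Ft := {fraction {poly P}}.

Definition tz_t : Ft := 'X%:F.
Definition tz_z (i : 'I_n) : Ft := (('X_i : P)%:P)%:F.
Definition tz_kappa : Ft := ((kappa%:MP : P)%:P)%:F.

Definition Phi : Ft := \prod_a poch (tz_t - tz_z a) tz_kappa k.

Definition eta (a : 'I_n) : Ft :=
  (tz_t - tz_z a)^-1 *
  \prod_(j < n | (j < a)%N) ((tz_t - tz_z j + 1) / (tz_t - tz_z j)).

Definition Qfun (a : 'I_n) : Ft := Phi * eta a.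

(* Q(t, z; kappa) = sum_i Q^i(z; kappa) (t; kappa)_i *)
Definition Q_expansion (c : nat -> 'cV[P]_n) : Prop :=
  exists N, (forall i, (N <= i)%N -> c i = 0) /\
    forall a, Qfun a = \sum_(i < N) ((c i a 0)%:P)%:F * poch tz_t tz_kappa i.

Lemma tz_neq0 i : tz_t - tz_z i != 0.
Proof. by rewrite -rmorphB tofrac_eq0 polyXsubC_eq0. Qed.

Lemma Qfun_poly a : (0 < k)%N -> {q : {poly P} | Qfun a = q%:F}.
Proof.
move=> k_gt0; pose x j : {poly P} := 'X - ('X_j : P)%:P.
exists (poch_quot x (kappa%:MP)%:P k a).
rewrite /Qfun /Phi /eta (poch_quotE _ _ k_gt0 tz_neq0) rmorph_poch_quot.
have xE j : tz_t - tz_z j = (@FracField.tofrac _ \o x) j by rewrite /= rmorphB.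
by apply: eq_bigr => j _; rewrite xE.
Qed.

Lemma Q_expansion_exists :
  {c : nat -> 'cV[P]_n | (0 < k)%N -> Q_expansion c}.
Proof.
case: (ltnP 0 k) => [k_gt0|]; last by exists (fun=> 0).
pose q a := sval (Qfun_poly a k_gt0).
pose N := \max_a size (q a).
have hN a : (size (q a) <= N)%N by rewrite /N (leq_bigmax a).
pose c a := sval (poch_basis kappa%:MP (hN a)).
exists (fun i => if (i < N)%N then \col_a c a i else 0) => _; exists N; split.
  by move=> i; rewrite leqNgt => /negbTE ->.
move=> a; rewrite (svalP (Qfun_poly a k_gt0)) -/(q a).
rewrite {1}(svalP (poch_basis kappa%:MP (hN a))) rmorph_sum /=.
by apply: eq_bigr => i _; rewrite ltn_ord mxE rmorphM /= rmorph_poch.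
Qed.

Lemma Q_expansion_unique c c' : Q_expansion c -> Q_expansion c' -> c =1 c'.
Proof.
have z0 (d : nat -> 'cV[P]_n) m a :
    (forall i, (m <= i)%N -> d i = 0) -> forall i, (m <= i)%N -> d i a 0 = 0.
  by move=> d0 l /d0 ->; rewrite mxE.
have sumF (d : nat -> P) m : \sum_(i < m) ((d i)%:P)%:F * poch tz_t tz_kappa i =
    (\sum_(i < m) (d i)%:P * poch 'X (kappa%:MP)%:P i)%:F.
  by rewrite rmorph_sum; apply: eq_bigr => i _; rewrite rmorphM rmorph_poch.
move=> [N [c0 hc]] [N' [c'0 hc']].
suff E a : (fun i => c i a 0) =1 (fun i => c' i a 0).
  by move=> i; apply/colP => a; exact: E a i.
apply: (@poch_inj _ kappa%:MP N N'); [exact: z0 | exact: z0 |].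
apply/eqP; rewrite -tofrac_eq; apply/eqP.
rewrite -(sumF (fun i => c i a 0)) -(sumF (fun i => c' i a 0)).
exact: etrans (esym (hc a)) (hc' a).
Qed.

(* The vectors Q^i(z; kappa); the Q_a are polynomials in t only for k > 0. *)
Definition Qcoef : nat -> 'cV[P]_n := sval Q_expansion_exists.

Lemma QcoefP : (0 < k)%N -> Q_expansion Qcoef.
Proof. exact: svalP Q_expansion_exists. Qed.

End Hypergeometric.

Definition Qsol (K : fieldType) (n : nat) (kappa : K) (k p l : nat) :
    'cV[ratfun K n]_n :=
  map_mx (@FracField.tofrac _) (Qcoef n kappa k (l * p).-1).

(* d(kappa), with k determined by kappa k = -1 mod p *)
Definition dnum (p n k : nat) : nat := (k * n) %/ p.

(* Main.v *)
(* A V-valued solution f is read as a linear functional x on the space M of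
   polynomials g(t) of degree < n (the numerators of g / prod_j (t - z_j)),
   with x(numerator of eta_b) = f_b.  An R-matrix exchanges two neighbours in
   the order of the indices which defines the eta_b, and the qKZ equation in
   z_a becomes a comparison of x with its shift, where only the term of index
   a is moved, by t -> t + kappa.
   The product of Phi with g / prod_j (t - z_j) is psi g, where psi =
   prod_j prod_(0 < i < k) (t - z_j - i kappa), and the comparison changes psi g
   by a coboundary G(t - kappa) - G(t).  After p steps one is back at z_a: x vanishes
   on an element g_a with psi g_a = G_a(t - kappa) - G_a(t), where G_a is 1 at
   the points z_a + i kappa and 0 at z_j + i kappa for j <> a, 0 <= i < k (this is
   where d(kappa) > 0 is needed).  Interpolation at these k n points shows that
   the g_a, and the coboundary of prod_j (t - z_j; kappa)_k killed by x because
   f is V-valued, span all g in M for which psi g is a coboundary.  So x only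
   depends on the class of psi g modulo coboundaries, that is on the
   coefficients of psi g at (t; kappa)_(l p - 1): this writes f in terms of the
   Q^(l p - 1), and the same invariance makes the coefficients invariant under
   the shifts of the z_a, hence rational in the z_a^p - z_a. *)
From HB Require Import structures.
Require Import Defs.
From mathcomp Require Import all_boot all_order all_algebra.
From mathcomp Require Import generic_quotient perm mpoly.
From mathcomp Require Import ring zify.

Set Implicit Arguments.
Unset Strict Implicit.
Unset Printing Implicit Defensive.

Import GRing.Theory.
Local Open Scope ring_scope.

(** * Backward differences and points of F_p *)

Section Difference.
Variables (A : comNzRingType) (kappa : A).

Definition bdiff (G : {poly A}) : {poly A} := G \Po ('X - kappa%:P) - G.

Fact bdiff_is_linear : linear bdiff.
Proof. by move=> c G H; rewrite /bdiff linearP opprD addrACA -scalerBr. Qed.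
HB.instance Definition _ :=
  GRing.isLinear.Build A {poly A} {poly A} _ bdiff bdiff_is_linear.

Lemma bdiffD G H : bdiff (G + H) = bdiff G + bdiff H.
Proof. exact: linearD. Qed.

Lemma bdiffZ c G : bdiff (c *: G) = c *: bdiff G.
Proof. exact: linearZ. Qed.

Lemma horner_bdiff G x : (bdiff G).[x + kappa] = G.[x] - G.[x + kappa].
Proof. by rewrite /bdiff !hornerE horner_comp !hornerE addrK. Qed.

Lemma bdiff_poch s :
  bdiff (poch ('X + kappa%:P) kappa%:P s.+1) = - (kappa *+ s.+1) *: poch 'X kappa%:P s.
Proof.
rewrite /bdiff (rmorph_poch (comp_poly ('X - kappa%:P))) rmorphD /= comp_polyX comp_polyC subrK.
rewrite pochS poch_recl addrK -mul_polyC polyCN polyCMn mulrSr.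
ring.
Qed.

End Difference.

Lemma size_bdiff (E : fieldType) (kappa : E) (G : {poly E}) :
  (size (bdiff kappa G) <= (size G).-1)%N.
Proof.
have [->|G0] := eqVneq G 0; first by rewrite linear0 size_poly0.
have s2 : size ('X - kappa%:P : {poly E}) = 2 by rewrite size_XsubC.
have sG := size_comp_poly2 G s2.
apply/leq_sizeP => j hj; rewrite coefB.
have [jG|jG] := eqVneq j (size G).-1; last first.
  have hj' : (size G <= j)%N by rewrite -(prednK (_ : 0 < size G)%N) ?size_poly_gt0 // ltn_neqAle eq_sym jG.
  by rewrite !nth_default ?subr0 ?sG.
have s2' : (size ('X - kappa%:P : {poly E})%R > 1)%N by rewrite s2.
have := lead_coef_comp G s2'.
by rewrite /lead_coef sG -jG s2 /= coefB coefX coefC subr0 expr1n mulr1 => ->; rewrite subrr.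
Qed.

Section Interpolation.
Variables (E : fieldType) (I : finType) (pt : I -> E).
Hypothesis pt_inj : injective pt.

Lemma prod_XsubC_dvdp (P : {poly E}) :
  (forall i, P.[pt i] = 0) -> \prod_i ('X - (pt i)%:P) %| P.
Proof.
move=> P0; rewrite -(big_map pt xpredT (fun x => 'X - x%:P)).
apply: uniq_roots_dvdp; first by apply/allP => x /mapP[i _ ->]; rewrite /root P0.
by rewrite uniq_rootsE map_inj_uniq ?index_enum_uniq.
Qed.

Lemma size_prod_XsubC_fin : size (\prod_i ('X - (pt i)%:P)) = #|I|.+1.
Proof. by rewrite size_prod_XsubC -[index_enum I]enumT -cardT. Qed.

Lemma interpolation (y : I -> E) :
  exists2 G : {poly E}, (size G <= #|I|)%N & forall i, G.[pt i] = y i.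
Proof.
pose L i := \prod_(j | j != i) ('X - (pt j)%:P).
have Lj i j : j != i -> (L i).[pt j] = 0.
  by move=> ji; rewrite /L (bigD1 j) //= hornerM hornerXsubC subrr mul0r.
have Li i : (L i).[pt i] != 0.
  rewrite /L horner_prod prodf_seq_neq0; apply/allP => j _; apply/implyP => ji.
  by rewrite hornerXsubC subr_eq0 (inj_eq pt_inj) eq_sym.
have sL i : (size (L i) <= #|I|)%N.
  have := size_prod_XsubC_fin; rewrite (bigD1 i) //= -/(L i).
  by rewrite mulrC size_Mmonic ?monicXsubC ?size_XsubC ?addn2 ?monic_neq0 ?monic_prod_XsubC //
     => [[->]].
exists (\sum_i (y i / (L i).[pt i]) *: L i).
  apply: (leq_trans (size_sum _ _ _)); apply/bigmax_leqP => i _.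
  exact: leq_trans (size_scale_leq _ _) (sL i).
move=> i; rewrite horner_sum (bigD1 i) //= big1 ?addr0 => [|j ji].
  by rewrite hornerZ divfK.
by rewrite hornerZ (Lj j i) ?mulr0 // eq_sym.
Qed.

End Interpolation.

(** * Multiples of the step in F_p; from here on the exponent k of the statement is [k.+1] *)

Section StepInFp.
Variables (E : fieldType) (p k : nat) (kappa : E).
Hypotheses (pchar : p \in [pchar E]) (kp : (k.+1 < p)%N).
Hypothesis kappak : kappa *+ k.+1 = -1.

Lemma kappa_neq0 : kappa != 0.
Proof.
apply/eqP => k0; move/eqP: kappak.
by rewrite k0 mul0rn eq_sym oppr_eq0 oner_eq0.
Qed.

Lemma kappa_mulrn_eq0 m : (kappa *+ m == 0) = (p %| m)%N.
Proof. by rewrite -mulr_natr mulf_eq0 (negPf kappa_neq0) /= (dvdn_pcharf pchar). Qed.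

Lemma kappa_mulrn_mod m : kappa *+ (m %% p) = kappa *+ m.
Proof.
by rewrite {2}(divn_eq m p) mulrnDr mulnC mulrnA (mulrn_pchar pchar) mul0rn add0r.
Qed.

Lemma kappa_mulrn_inj m m' :
  (m < p)%N -> (m' < p)%N -> kappa *+ m = kappa *+ m' -> m = m'.
Proof.
wlog le_m : m m' / (m <= m')%N => [th hm hm' e|_ hm'].
  by case/orP: (leq_total m m') => h; [exact: th | symmetry; exact: th].
move/eqP; rewrite eq_sym -subr_eq0 -mulrnBr // kappa_mulrn_eq0 => /dvdnP[[|q]]; first lia.
by rewrite mulSn; lia.
Qed.

(** Frobenius fixes -1 = (k + 1) [kappa], and k + 1 is invertible mod p, so it fixes [kappa]. *)
Lemma kappa_expp : kappa ^+ p = kappa.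
Proof.
have := congr1 (pFrobenius_aut pchar) kappak.
rewrite pFrobenius_autMn pFrobenius_autN pFrobenius_aut1 -kappak pFrobenius_autE.
move/eqP; rewrite -subr_eq0 -mulrnBl -mulr_natr mulf_eq0 -(dvdn_pcharf pchar) subr_eq0.
by case/orP => [/eqP //|/dvdn_leq]; lia.
Qed.

(** Fermat's little theorem: 1 - x^(p-1) is the indicator function of 0 on F_p. It later yields an
    element of mass 1 and one of trace 1. *)
Lemma kappa_fermat m : (m < p)%N -> 1 - (kappa *+ m) ^+ p.-1 = (m == 0)%:R.
Proof.
have p_gt1 := prime_gt1 (pcharf_prime pchar).
move=> mp; case: eqP => [->|/eqP m0]; first by rewrite expr0n -subn1 subn_eq0 leqNgt p_gt1 subr0.
have nz : kappa *+ m != 0.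
  by rewrite kappa_mulrn_eq0; apply/negP => /dvdn_leq; lia.
apply/eqP; rewrite subr_eq0 eq_sym; apply/eqP; apply: (mulfI nz).
rewrite mulr1 -exprS prednK ?(ltnW p_gt1) // -(pFrobenius_autE pchar) pFrobenius_autMn.
by rewrite pFrobenius_autE kappa_expp.
Qed.

(** The factor [kappa *+ s.+1] of [bdiff_poch] can be inverted unless p divides s + 1. Hence only
    the indices l p - 1 matter modulo coboundaries. *)
Lemma poch_bdiff s : ~~ (p %| s.+1)%N ->
  exists G, poch 'X kappa%:P s = bdiff kappa G.
Proof.
rewrite -kappa_mulrn_eq0 => nz.
exists (- (kappa *+ s.+1)^-1 *: poch ('X + kappa%:P) kappa%:P s.+1).
by rewrite linearZ /= bdiff_poch scalerA mulrNN mulVf ?scale1r.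
Qed.

(** If p divides deg G, [bdiff_poch] provides a polynomial of that degree with zero difference,
    which removes the leading term. Otherwise the difference has degree exactly deg G - 1, so G
    already satisfies the bound. *)
Lemma bdiff_reduce (G : {poly E}) N : (size (bdiff kappa G) <= N)%N ->
  exists2 G', bdiff kappa G' = bdiff kappa G & (size G' <= N.+1)%N.
Proof.
move: {2}(size G) (leqnn (size G)) => s; elim: s G => [|s IH] G hG sN.
  by exists G => //; apply: leq_trans hG _.
have [GN|GN] := leqP (size G) N.+1; first by exists G.
case: s IH hG => [|s] IH hG; first by have := leq_trans GN hG.
move: hG; rewrite leq_eqVlt => /predU1P[sG|hG]; last exact: IH.
pose e := poch ('X + kappa%:P) kappa%:P s.+1.
have eE : e = poch 'X kappa%:P s.+1 \Po ('X + kappa%:P).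
  by rewrite (rmorph_poch (comp_poly _)) /= comp_polyX comp_polyC.
have sX : size ('X + kappa%:P : {poly E}) = 2.
  by rewrite -[kappa%:P]opprK -polyCN size_XsubC.
have se : size e = s.+2 by rewrite eE size_comp_poly2 ?size_poch.
have lc_e : e`_s.+1 = 1.
  have sX' : (size ('X + kappa%:P : {poly E})%R > 1)%N by rewrite sX.
  have := lead_coef_comp (poch 'X kappa%:P s.+1) sX'.
  rewrite -eE {1}/lead_coef se (monicP (monic_poch _ _)) mul1r /= => ->.
  by rewrite -[kappa%:P]opprK -polyCN lead_coefXsubC expr1n.
have sG1 : (size (G - G`_s.+1 *: e)%R <= s.+1)%N.
  apply/leq_sizeP => j; rewrite leq_eqVlt => /predU1P[<-|hj].
    by rewrite coefB coefZ lc_e mulr1 subrr.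
  by rewrite coefB coefZ [G`_j]nth_default ?[e`_j]nth_default ?mulr0 ?subr0 ?se ?sG.
have pe : bdiff kappa e = - (kappa *+ s.+1) *: poch 'X kappa%:P s by exact: bdiff_poch.
have [ps|ps] := boolP (p %| s.+1)%N.
  have pG : bdiff kappa (G - G`_s.+1 *: e) = bdiff kappa G.
    rewrite linearB linearZ /= pe; move: ps; rewrite -kappa_mulrn_eq0 => /eqP ->.
    by rewrite oppr0 scale0r scaler0 subr0.
  by rewrite -pG; apply: IH; rewrite ?pG.
have G_neq0 : G`_s.+1 != 0.
  by rewrite -[s.+1]/s.+2.-1 -sG -lead_coefE lead_coef_eq0 -size_poly_gt0 sG.
exfalso.
have : (bdiff kappa G)`_s = - (kappa *+ s.+1) * G`_s.+1.
  rewrite -{1}(subrK (G`_s.+1 *: e) G) linearD coefD nth_default ?add0r.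
    rewrite linearZ /= pe !coefZ; have := monicP (monic_poch kappa s).
    by rewrite lead_coefE size_poch /= => ->; rewrite mulr1 mulrC.
  by apply: leq_trans (size_bdiff _ _) _; rewrite -subn1 leq_subLR add1n.
rewrite nth_default; last by apply: leq_trans sN _; move: GN; rewrite sG.
by move/eqP; rewrite eq_sym mulf_eq0 oppr_eq0 kappa_mulrn_eq0 (negPf ps) (negPf G_neq0).
Qed.

End StepInFp.

(** * Transport of functionals and the p-curvature *)

Section PointProducts.
Variables (E : fieldType) (kappa : E).
Implicit Types z : E.

Definition pprod z m : {poly E} := \prod_(i < m) ('X - (z + kappa *+ i)%:P).

Lemma poch_pprod z m : poch ('X - z%:P) kappa%:P m = pprod z m.
Proof.
rewrite /poch /pprod big_add1 big_mkord; apply: eq_bigr => i _.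
by rewrite polyCD polyCMn opprD addrA.
Qed.

Lemma pprod_recl z m : pprod z m.+1 = ('X - z%:P) * pprod (z + kappa) m.
Proof.
rewrite /pprod big_ord_recl mulr0n addr0; congr (_ * _).
by apply: eq_bigr => i _; rewrite lift0 mulrS addrA.
Qed.

Lemma pprod_recr z m : pprod z m.+1 = pprod z m * ('X - (z + kappa *+ m)%:P).
Proof. by rewrite /pprod big_ord_recr. Qed.

Lemma pprod_comp z m : pprod z m \Po ('X - kappa%:P) = pprod (z + kappa) m.
Proof.
rewrite -!poch_pprod (rmorph_poch (comp_poly _)) rmorphB /= comp_polyX !comp_polyC.
by rewrite polyCD opprD addrAC addrA.
Qed.

Lemma pprod_root z m i : (i < m)%N -> (pprod z m).[z + kappa *+ i] = 0.
Proof.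
by move=> im; rewrite /pprod (bigD1 (Ordinal im)) //= hornerM hornerXsubC subrr mul0r.
Qed.

End PointProducts.

Section Hypergeometric.
Variables (E : fieldType) (p k n : nat) (kappa : E).
Hypotheses (pchar : p \in [pchar E]) (kp : (k.+1 < p)%N).
Hypothesis kappak : kappa *+ k.+1 = -1.

Local Notation phi z := (pprod kappa z k.+1).
Local Notation psi z := (pprod kappa (z + kappa) k).
Local Notation pdiff := (bdiff kappa).

Lemma phi_recl z : phi z = ('X - z%:P) * psi z.
Proof. exact: pprod_recl. Qed.

(** The last root z + (k + 1) [kappa] is z - 1. This is where the choice of k enters: translating by
    [kappa] turns the factor t - z into t - z + 1. *)
Lemma phi_recr z : phi (z + kappa) = psi z * ('X - z%:P + 1).
Proof.
rewrite pprod_recr -addrA -mulrS kappak; congr (_ * _).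
by rewrite polyCD polyCN opprD opprK addrA.
Qed.

(** * One transport step in the variable of index a *)

Section OneVariable.
Variables (z : 'I_n -> E) (a : 'I_n).

(** [lin_off] and [lin1_off] are the numerators of eta_a when a comes first, respectively last, in
    the order of the indices. *)
Definition lin_off : {poly E} := \prod_(j | j != a) ('X - (z j)%:P).
Definition lin1_off : {poly E} := \prod_(j | j != a) ('X - (z j)%:P + 1).
Definition psi_off : {poly E} := \prod_(j | j != a) psi (z j).
Definition phi_off : {poly E} := \prod_(j | j != a) phi (z j).

Lemma phi_offE : phi_off = psi_off * lin_off.
Proof. by rewrite -big_split; apply: eq_bigr => j _; rewrite phi_recl mulrC. Qed.

Lemma phi_off_comp : phi_off \Po ('X - kappa%:P) = psi_off * lin1_off.
Proof.
rewrite -big_split (rmorph_prod (comp_poly _)); apply: eq_bigr => j _.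
by rewrite /= pprod_comp phi_recr.
Qed.

Lemma bdiff_phi_phi_off v :
  pdiff (phi v * phi_off) = psi v * psi_off * (('X - v%:P + 1) * lin1_off - ('X - v%:P) * lin_off).
Proof.
by rewrite /bdiff rmorphM /= pprod_comp phi_off_comp phi_recr phi_offE phi_recl; ring.
Qed.

Lemma monic_lin_off : lin_off \is monic. Proof. exact: monic_prod_XsubC. Qed.

Lemma size_lin_off : size lin_off = n.
Proof.
have := size_prod_XsubC_fin z; rewrite (bigD1 a) //= -/lin_off card_ord.
rewrite mulrC size_Mmonic ?monicXsubC ?size_XsubC ?addn2 ?monic_neq0 ?monic_lin_off //.
by case.
Qed.

Let n_gt0 : (0 < n)%N. Proof. by case: n a => [[]|]. Qed.

Lemma lin1_offB : lin1_off - lin_off = bdiff (-1) lin_off.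
Proof.
congr (_ - _); rewrite (rmorph_prod (comp_poly _)); apply: eq_bigr => j _ /=.
by rewrite rmorphB /= comp_polyX comp_polyC polyCN opprK addrAC.
Qed.

Lemma size_lin1_offB : (size (lin1_off - lin_off)%R < n)%N.
Proof.
by rewrite lin1_offB (leq_ltn_trans (size_bdiff _ _)) ?size_lin_off ?ltn_predL.
Qed.

(** The relations only move [lin_off] and multiples of t - v + 1. So a multiple c of [lin_off] is
    added to (t - v) q to create a root at v - 1. After the move, the term - c x'([lin1_off]) is
    turned into the value at a multiple of t - v - [kappa] by the third relation, and the net change
    of the product is c times a coboundary. *)
Lemma transport_step v (x x' : {linear {poly E} -> E^o}) (q : {poly E}) :
  lin_off.[v - 1] != 0 ->
  (forall g : {poly E}, (size g < n)%N ->
     x (('X - v%:P + 1) * g) = x' (('X - (v + kappa)%:P) * g)) ->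
  x lin_off = x' lin1_off ->
  x' (lin1_off + ('X - (v + kappa)%:P) * (lin1_off - lin_off)) = 0 ->
  (size q < n)%N ->
  exists (c : E) (q1 : {poly E}), [/\ (size q1 < n)%N,
    x (('X - v%:P) * q) = x' (('X - (v + kappa)%:P) * q1) &
    phi (v + kappa) * psi_off * q1 = phi v * psi_off * q + c *: pdiff (phi v * phi_off)].
Proof.
move=> Dv R1 R2 R3 sq; pose c := q.[v - 1] / lin_off.[v - 1].
have : root (('X - v%:P) * q + c *: lin_off) (v - 1).
  by rewrite /root !hornerE /c divfK // addrAC subrr add0r mulN1r addNr.
case/factor_theorem => g0 g0E.
have LE : 'X - (v - 1)%:P = 'X - v%:P + 1 by rewrite polyCB opprB addrA addrAC.
rewrite LE in g0E.
have sg0 : (size g0 < n)%N.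
  have [->|g0_neq0] := eqVneq g0 0; first by rewrite size_poly0.
  have : (size (('X - v%:P) * q + c *: lin_off)%R <= n)%N.
    rewrite (leq_trans (size_polyD _ _)) // geq_max (leq_trans (size_scale_leq _ _)) ?size_lin_off //.
    rewrite andbT mulrC; have [->|q0] := eqVneq q 0; first by rewrite mul0r size_poly0.
    by rewrite size_Mmonic ?monicXsubC // size_XsubC addn2.
  by rewrite g0E -LE size_Mmonic ?monicXsubC // size_XsubC addn2.
exists c, (g0 + c *: (lin1_off - lin_off)); split.
- rewrite (leq_ltn_trans (size_polyD _ _)) // gtn_max sg0 /=.
  exact: leq_ltn_trans (size_scale_leq _ _) size_lin1_offB.
- have -> : ('X - v%:P) * q = ('X - v%:P + 1) * g0 - c *: lin_off.
    by rewrite mulrC -mulrC [_ * g0]mulrC -g0E addrK.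
  rewrite linearB linearZ R1 // R2 mulrDr linearD -scalerAr [x' (c *: _)]linearZ /=.
  move: R3; rewrite linearD => /eqP; rewrite addr_eq0 => /eqP ->.
  by rewrite scalerN opprK.
- rewrite bdiff_phi_phi_off phi_recr phi_recl mulrDr.
  have -> : psi v * ('X - v%:P + 1) * psi_off * g0 = psi v * psi_off * (('X - v%:P) * q + c *: lin_off).
    by rewrite g0E; ring.
  by rewrite -!mul_polyC; ring.
Qed.

Lemma phi_phi_offE v : phi v * phi_off = \prod_j phi (if j == a then v else z j).
Proof.
rewrite [RHS](bigD1 a) //= eqxx; congr (_ * _).
by apply: eq_bigr => j /negPf ->.
Qed.

End OneVariable.

Lemma big_prod_pprod m (z : 'I_n -> E) :
  \prod_j pprod kappa (z j) m = \prod_(i : 'I_n * 'I_m) ('X - (z i.1 + kappa *+ i.2)%:P).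
Proof. by rewrite pair_bigA. Qed.

Lemma size_prod_pprod m (z : 'I_n -> E) :
  size (\prod_j pprod kappa (z j) m) = (n * m).+1.
Proof. by rewrite big_prod_pprod size_prod_XsubC_fin card_prod !card_ord. Qed.

Lemma monic_prod_pprod m (z : 'I_n -> E) : \prod_j pprod kappa (z j) m \is monic.
Proof. by rewrite big_prod_pprod monic_prod_XsubC. Qed.

Lemma horner_bdiffE G x : (pdiff G).[x] = G.[x - kappa] - G.[x].
Proof. by rewrite -{1}[x](subrK kappa) horner_bdiff subrK. Qed.

(** The sum telescopes around the orbit x + F_p, which closes up because p [kappa] = 0. *)
Lemma sum_bdiff (G : {poly E}) x : \sum_(i < p) (pdiff G).[x + kappa *+ i] = 0.
Proof.
rewrite -(big_mkord xpredT (fun i => (pdiff G).[x + kappa *+ i])).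
rewrite (eq_bigr (fun i => - (G.[x + kappa *+ i.+1 - kappa] - G.[x + kappa *+ i - kappa]))).
  rewrite sumrN telescope_sumr // (mulrn_pchar pchar) mulr0n subrr oppr0 //.
by move=> i _; rewrite horner_bdiffE mulrSr addrA addrK opprB.
Qed.

Section Generic.
Variable z : 'I_n -> E.
Hypothesis z_generic : forall i j m, i != j -> z i + kappa *+ m != z j.

Definition psi_prod : {poly E} := \prod_j psi (z j).
Definition phi_prod : {poly E} := \prod_j phi (z j).
(** This is the sum of the numerators of all eta_b (see [sum_numer]), on which the functional takes
    the value f_1 + ... + f_n. *)
Definition lin_diff : {poly E} :=
  \prod_j ('X - (z j)%:P + 1) - \prod_j ('X - (z j)%:P).

Lemma points_inj (i i' : 'I_n * 'I_p) :
  z i.1 + kappa *+ i.2 = z i'.1 + kappa *+ i'.2 -> i = i'.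
Proof.
case: i i' => [j m] [j' m'] /= e.
have [jj'|jj'] := eqVneq j j'.
  rewrite jj' in e *; congr (_, _); apply: val_inj.
  by move/addrI: e; apply: (kappa_mulrn_inj pchar kp kappak); exact: ltn_ord.
(* The natural number m + (p - m') represents m - m' mod p. *)
case/negP: (z_generic (m + (p - m')) jj'); apply/eqP.
rewrite mulrnDr addrA e -addrA -mulrnDr subnKC ?(ltnW (ltn_ord m')) //.
by rewrite (mulrn_pchar pchar) addr0.
Qed.

Lemma points_inj_le m : (m <= p)%N ->
  injective (fun i : 'I_n * 'I_m => z i.1 + kappa *+ i.2).
Proof.
move=> mp [j i] [j' i'] e.
by have [-> /val_inj ->] := points_inj (i := (j, widen_ord mp i)) (i' := (j', widen_ord mp i')) e.
Qed.

Lemma lin_off_neq0 a m : (lin_off z a).[z a + kappa *+ m] != 0.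
Proof.
rewrite horner_prod prodf_seq_neq0; apply/allP => j _; apply/implyP => ja.
by rewrite hornerXsubC subr_eq0 z_generic // eq_sym.
Qed.

Section PCurvature.
Variables (a : 'I_n) (y : nat -> {linear {poly E} -> E^o}).
Let v m := z a + kappa *+ m.
Hypothesis R1 : forall m (g : {poly E}), (size g < n)%N ->
  y m (('X - (v m)%:P + 1) * g) = y m.+1 (('X - (v m.+1)%:P) * g).
Hypothesis R2 : forall m, y m (lin_off z a) = y m.+1 (lin1_off z a).
Hypothesis R3 : forall m,
  y m.+1 (lin1_off z a + ('X - (v m.+1)%:P) * (lin1_off z a - lin_off z a)) = 0.
Hypothesis y_period : y p =1 y 0.

Let vS m : v m + kappa = v m.+1.
Proof. by rewrite /v mulrSr addrA. Qed.

(* Carrying q once around the orbit z a + F_p moves the whole mass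
   sum_(i < p) (phi (z a) psi_off q)(z a + i kappa) across the cut between
   z a - kappa and z a; G records the total flow through each cut. *)
Lemma transport_chain (q : {poly E}) m : (size q < n)%N ->
  exists r G : {poly E}, [/\ (size r < n)%N /\ (size G <= (n * k.+1).+1)%N,
    y 0 (('X - (z a)%:P) * q) = y m (('X - (v m)%:P) * r),
    phi (v m) * psi_off z a * r = phi (z a) * psi_off z a * q + pdiff G,
    forall j i, j != a -> (i < k.+1)%N -> G.[z j + kappa *+ i] = 0 &
    \sum_(i < m) (phi (v m) * psi_off z a * r).[v i] = G.[z a - kappa]].
Proof.
move=> sq; elim: m => [|m [r [G [[sr sG] yE FE G0 GE]]]].
  exists q, 0; rewrite /v mulr0n addr0 linear0 addr0 big_ord0 horner0 size_poly0.
  by split => // j i _ _; rewrite horner0.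
have Dv : (lin_off z a).[v m - 1] != 0.
  by rewrite /v -kappak -addrA -mulrnDr lin_off_neq0.
have [||c [q1 [sq1 xE qE]]] := transport_step Dv _ (R2 m) _ sr.
- by move=> g sg; rewrite vS R1.
- by rewrite vS R3.
rewrite vS in xE qE; pose H := phi (v m) * phi_off z a.
exists q1, (G + c *: H); split.
- split=> //; rewrite (leq_trans (size_polyD _ _)) // geq_max sG.
  rewrite (leq_trans (size_scale_leq _ _)) // /H phi_phi_offE.
  by rewrite (size_prod_pprod _ (fun j => if j == a then v m else z j)).
- by rewrite yE xE.
- by rewrite qE FE bdiffD bdiffZ -addrA.
- move=> j i ja ik; rewrite hornerD hornerZ G0 // /H /phi_off (bigD1 j) //= !hornerM.
  by rewrite pprod_root // mul0r mulr0 mulr0 addr0.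
rewrite qE; set F := phi (v m) * _ * r in FE GE *.
have Hm : H.[v m] = 0 by rewrite /H hornerM -{2}[v m]addr0 -(mulr0n kappa) pprod_root ?mul0r.
have Fm : F.[v m] = 0.
  by rewrite /F !hornerM -{2}[v m]addr0 -(mulr0n kappa) pprod_root ?mul0r.
(* Since [H] vanishes at [v m], only the value just before the first point survives. [F] vanishes at
   [v m] too, so the sum can be extended by that point. *)
have tele : \sum_(i < m.+1) (pdiff H).[v i] = H.[z a - kappa].
  rewrite -(big_mkord xpredT (fun i => (pdiff H).[v i])).
  have -> : H.[z a - kappa] = - (H.[v m.+1 - kappa] - H.[v 0 - kappa]).
    by rewrite -vS addrK Hm /v mulr0n addr0 sub0r opprK.
  rewrite -(telescope_sumr (fun i => H.[v i - kappa])) // -sumrN; apply: eq_bigr => i _.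
  by rewrite horner_bdiffE -vS addrK opprB.
rewrite (eq_bigr (fun i : 'I_m.+1 => F.[v i] + c * (pdiff H).[v i])); last first.
  by move=> i _; rewrite hornerD hornerZ.
by rewrite big_split -mulr_sumr tele big_ord_recr /= Fm addr0 GE hornerD hornerZ.
Qed.

(** The flow through the cut before z_a is the total mass 1. As [pdiff G] has the factor
    [phi (z a)], G keeps this value at z_a, ..., z_a + k [kappa]. *)
Lemma p_curvature (q : {poly E}) : (size q < n)%N ->
  \sum_(i < p) (phi (z a) * psi_off z a * q).[v i] = 1 ->
  exists g G : {poly E}, [/\ (size g <= n)%N, (size G <= (n * k.+1).+1)%N, y 0 g = 0,
    psi_prod * g = pdiff G &
    forall j i, (i < k.+1)%N -> G.[z j + kappa *+ i] = (j == a)%:R].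
Proof.
move=> sq mass; have [r [G [[sr sG] yE FE G0 GE]]] := transport_chain p sq.
have vp : v p = z a by rewrite /v (mulrn_pchar pchar) addr0.
rewrite vp in yE FE GE.
have pE : pdiff G = phi (z a) * psi_off z a * (r - q).
  by rewrite mulrBr FE addrAC subrr add0r.
have Gcut : G.[z a - kappa] = 1.
  rewrite -GE FE -[RHS]addr0 -mass.
  rewrite (eq_bigr (fun i : 'I_p =>
    (phi (z a) * psi_off z a * q).[v i] + (pdiff G).[v i])) => [|i _].
    by rewrite big_split; congr (_ + _); exact: sum_bdiff.
  by rewrite hornerD.
exists (('X - (z a)%:P) * (r - q)), G; split=> //.
- have [->|nz] := eqVneq (r - q) 0; first by rewrite mulr0 size_poly0.
  rewrite mulrC size_Mmonic ?monicXsubC // size_XsubC addn2.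
  by rewrite (leq_ltn_trans (size_polyD _ _)) // size_polyN gtn_max sr.
- by rewrite mulrBr linearB yE y_period subrr.
- by rewrite pE /psi_prod (bigD1 a) //= phi_recl /psi_off; ring.
move=> j i ik; have [->|ja] := eqVneq j a; last exact: G0.
rewrite -Gcut; elim: i ik => [|i IH] ik.
  have := congr1 (fun P => P.[z a + kappa *+ 0]) pE.
  rewrite !hornerM pprod_root // !mul0r horner_bdiffE mulr0n addr0.
  by move/eqP; rewrite subr_eq0 => /eqP.
have := congr1 (fun P => P.[z a + kappa *+ i.+1]) pE.
rewrite !hornerM pprod_root // !mul0r horner_bdiffE mulrSr addrA addrK.
by move/eqP; rewrite subr_eq0 IH ?(ltnW ik) // => /eqP.
Qed.

End PCurvature.

Lemma phi_psi_offE a q : phi (z a) * psi_off z a * q = psi_prod * (('X - (z a)%:P) * q).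
Proof. by rewrite /psi_prod (bigD1 a) //= phi_recl /psi_off; ring. Qed.

Lemma psi_prod_lin_diff : psi_prod * lin_diff = pdiff phi_prod.
Proof.
rewrite /bdiff mulrBr -!big_split (rmorph_prod (comp_poly _)) /=; congr (_ - _).
  by apply: eq_bigr => j _; rewrite /= pprod_comp phi_recr.
by apply: eq_bigr => j _; rewrite phi_recl mulrC.
Qed.

Lemma size_lin_diff : (0 < n)%N -> (size lin_diff <= n)%N.
Proof.
move=> n_gt0; have -> : lin_diff = bdiff (-1) (\prod_j ('X - (z j)%:P)).
  congr (_ - _); rewrite (rmorph_prod (comp_poly _)); apply: eq_bigr => j _ /=.
  by rewrite rmorphB /= comp_polyX comp_polyC polyCN opprK addrAC.
by rewrite (leq_trans (size_bdiff _ _)) // size_prod_XsubC_fin card_ord.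
Qed.

Lemma psi_prod_neq0 : psi_prod != 0.
Proof. by rewrite monic_neq0 // (monic_prod_pprod k (fun j => z j + kappa)). Qed.

Lemma size_psi_prod : size psi_prod = (n * k).+1.
Proof. exact: (size_prod_pprod k (fun j => z j + kappa)). Qed.

(* The values of G at the n k points z j + i kappa are free, and determine
   those of pdiff G at the zeros of psi_prod. *)
Lemma psi_prod_mod_bdiff (P : {poly E}) : (0 < n)%N -> (size P <= n * k.+1)%N ->
  exists g G : {poly E}, (size g <= n)%N /\ psi_prod * g = P + pdiff G.
Proof.
move=> n_gt0 sP.
(* Partial sums of P starting from 0 at z_j: they solve G(t - kappa) - G(t) = - P(t) at the roots of
   [psi_prod]. *)
have [G sG GE] := interpolation (points_inj_le (ltnW kp))
  (fun i => \sum_(l < i.2) P.[z i.1 + kappa *+ l.+1]).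
rewrite card_prod !card_ord in sG.
have psub : injective (fun i : 'I_n * 'I_k => z i.1 + kappa + kappa *+ i.2).
  move=> [j i] [j' i']; rewrite /= -!addrA -!mulrS => e.
  have hk (l : 'I_k) : (l.+1 < p)%N by have := ltn_ord l; lia.
  have [-> e'] := points_inj (i := (j, Ordinal (hk i))) (i' := (j', Ordinal (hk i'))) e.
  by congr (_, _); apply: val_inj.
have /dvdpP[g gE] : psi_prod %| P + pdiff G.
  rewrite /psi_prod (big_prod_pprod k (fun j => z j + kappa)); apply: prod_XsubC_dvdp => // -[j i] /=.
  have ik : (i < k.+1)%N by rewrite ltnW // ltnS.
  have ik' : (i.+1 < k.+1)%N by rewrite ltnS.
  have GS := GE (j, Ordinal ik'); have Gi := GE (j, Ordinal ik).
  rewrite /= in GS Gi.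
  have e : z j + kappa *+ i.+1 - kappa = z j + kappa *+ i by rewrite mulrSr addrA addrK.
  rewrite -[z j + _ + _]addrA -mulrS hornerD horner_bdiffE e Gi GS big_ord_recr /=.
  by rewrite opprD addNKr subrr.
exists g, G; split; last by rewrite mulrC.
have [->|g0] := eqVneq g 0; first by rewrite size_poly0.
have : (size (g * psi_prod)%R <= n * k.+1)%N.
  rewrite -gE (leq_trans (size_polyD _ _)) // geq_max sP (leq_trans (size_bdiff _ _)) //.
  exact: leq_trans (leq_pred _) sG.
by rewrite size_mul // ?psi_prod_neq0 // size_psi_prod addnS mulnS leq_add2r.
Qed.

Lemma z1_neq a j : z a + 1 != z j.
Proof.
have [->|ja] := eqVneq j a.
  by rewrite -subr_eq0 addrAC subrr add0r oner_eq0.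
have -> : 1 = kappa *+ (p - k.+1).
  by rewrite mulrnBr ?(ltnW kp) // (mulrn_pchar pchar) kappak sub0r opprK.
by rewrite z_generic // eq_sym.
Qed.

(** The product of [psi_prod] and [lin_diff] is a coboundary and [lin_diff] does not vanish at z_a,
    so a multiple of it can be added to g to create a root at z_a. *)
Lemma psi_prod_mod_bdiff_at a (P : {poly E}) : (size P <= n * k.+1)%N ->
  exists q G : {poly E}, (size q < n)%N /\ psi_prod * (('X - (z a)%:P) * q) = P + pdiff G.
Proof.
move=> sP; have n_gt0 : (0 < n)%N by case: n a => [[]|].
have [g [G [sg gE]]] := psi_prod_mod_bdiff n_gt0 sP.
have Ba : lin_diff.[z a] != 0.
  rewrite /lin_diff hornerD hornerN [X in _ - X]horner_prod [X in _ - X](bigD1 a) //=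
    hornerXsubC subrr mul0r subr0.
  rewrite horner_prod prodf_seq_neq0; apply/allP => j _ /=.
  by rewrite !hornerE addrAC subr_eq0 z1_neq.
pose c := - (g.[z a] / lin_diff.[z a]).
have : root (g + c *: lin_diff) (z a).
  by rewrite /root hornerD hornerZ mulNr divfK // subrr.
case/factor_theorem => q qE; exists q, (G + c *: phi_prod); split; last first.
  rewrite [_ * q]mulrC -qE mulrDr gE -scalerAr psi_prod_lin_diff.
  by rewrite bdiffD bdiffZ -addrA.
have [->|q0] := eqVneq q 0; first by rewrite size_poly0.
have : (size (g + c *: lin_diff)%R <= n)%N.
  rewrite (leq_trans (size_polyD _ _)) // geq_max sg.
  by rewrite (leq_trans (size_scale_leq _ _)) ?size_lin_diff.
by rewrite qE size_Mmonic ?monicXsubC // size_XsubC addn2.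
Qed.

(** The polynomial 1 - (t - z_a)^(p-1) is the indicator of z_a on z_a + F_p, hence has mass 1, and
    coboundaries have mass 0. The hypothesis, that is d(kappa) > 0, makes its degree p - 1 small
    enough for [psi_prod_mod_bdiff_at]. *)
Lemma unit_mass a : (p <= n * k.+1)%N -> exists2 q : {poly E}, (size q < n)%N &
  \sum_(i < p) (phi (z a) * psi_off z a * q).[z a + kappa *+ i] = 1.
Proof.
move=> pnk; have p_gt1 := prime_gt1 (pcharf_prime pchar).
have sP : (size (1 - ('X - (z a)%:P) ^+ p.-1)%R <= n * k.+1)%N.
  rewrite (leq_trans (size_polyD _ _)) // geq_max size_poly1 size_polyN size_exp_XsubC.
  by rewrite prednK ?(ltnW p_gt1) // pnk (leq_trans (ltnW p_gt1)).
have [q [G [sq qE]]] := psi_prod_mod_bdiff_at a sP; exists q => //.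
rewrite (eq_bigr (fun i : 'I_p => (i == 0 :> nat)%:R + (pdiff G).[z a + kappa *+ i])).
  rewrite big_split /= sum_bdiff addr0 -(big_mkord xpredT (fun i => (i == 0%N)%:R)).
  by rewrite big_ltn ?(ltnW p_gt1) //= big_nat big1 ?addr0 // => i /andP[]; case: i.
move=> i _; rewrite phi_psi_offE qE hornerD; congr (_ + _).
rewrite hornerD hornerN horner_exp hornerXsubC addrAC subrr add0r hornerC.
by rewrite (kappa_fermat pchar kp kappak).
Qed.

(** G is constant on each chain z_j, ..., z_j + k [kappa], as [psi_prod] vanishes at all its points
    but the first. Subtracting the G_a with weights G(z_a) leaves a multiple of [phi_prod], a
    constant one once [bdiff_reduce] has bounded the degree of G. So g is a combination of the g_a
    and [lin_diff], all killed by x. *)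
Lemma coboundary_eq0 (x : {linear {poly E} -> E^o}) : (0 < n)%N ->
  x lin_diff = 0 ->
  (forall a, exists g G : {poly E}, [/\ (size g <= n)%N, (size G <= (n * k.+1).+1)%N, x g = 0,
    psi_prod * g = pdiff G &
    forall j i, (i < k.+1)%N -> G.[z j + kappa *+ i] = (j == a)%:R]) ->
  forall g G : {poly E}, (size g <= n)%N -> psi_prod * g = pdiff G -> x g = 0.
Proof.
move=> n_gt0 xB pc g G0 sg gE0.
have [|G GE sG] := bdiff_reduce pchar kappak (G := G0) (N := n * k.+1).
  rewrite -gE0; have [->|g_neq0] := eqVneq g 0; first by rewrite mulr0 size_poly0.
  by rewrite size_mul ?psi_prod_neq0 // size_psi_prod /= addnC mulnS leq_add2r.
rewrite -GE in gE0 => {GE}.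
have /fin_all_exists2 : forall a, exists2 gG : {poly E} * {poly E},
    [/\ (size gG.1 <= n)%N, (size gG.2 <= (n * k.+1).+1)%N, x gG.1 = 0 &
    psi_prod * gG.1 = pdiff gG.2] &
    forall j i, (i < k.+1)%N -> gG.2.[z j + kappa *+ i] = (j == a)%:R.
  by move=> a; have [g1 [G1 [? ? ? ? ?]]] := pc a; exists (g1, G1).
case=> gG gGP gGv.
pose H := G - \sum_a G.[z a] *: (gG a).2.
have Gconst j i : (i < k.+1)%N -> G.[z j + kappa *+ i] = G.[z j].
  elim: i => [|i IH] ik; first by rewrite mulr0n addr0.
  have := congr1 (fun P => P.[z j + kappa *+ i.+1]) gE0.
  rewrite horner_bdiffE hornerM {1}mulrS addrA {1}/psi_prod horner_prod (bigD1 j) //=.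
  rewrite pprod_root // !mul0r mulrSr addrA addrK => /eqP.
  by rewrite eq_sym subr_eq0 -IH ?(ltnW ik) // => /eqP ->.
have : phi_prod %| H.
  rewrite /phi_prod (big_prod_pprod k.+1 z).
  apply: prod_XsubC_dvdp; first exact: points_inj_le (ltnW kp).
  case=> j i /=; rewrite hornerD hornerN horner_sum Gconst // (bigD1 j) //=.
  rewrite hornerZ gGv // eqxx mulr1 big1 ?addr0 ?subrr // => l lj.
  by rewrite hornerZ gGv // eq_sym (negPf lj) mulr0.
case/dvdpP => C HE.
have sH : (size H <= (n * k.+1).+1)%N.
  rewrite (leq_trans (size_polyD _ _)) // geq_max sG size_polyN.
  apply: leq_trans (size_sum _ _ _) _; apply/bigmax_leqP => a _.
  by have [_ h _ _] := gGP a; exact: leq_trans (size_scale_leq _ _) h.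
have sC : (size C <= 1)%N.
  have [->|C0] := eqVneq C 0; first by rewrite size_poly0.
  move: sH; rewrite HE size_Mmonic ?(monic_prod_pprod k.+1 z) //.
  by rewrite (size_prod_pprod k.+1 z) addnS /= -[X in (_ <= X)%N]add1n leq_add2r.
have CE := size1_polyC sC.
have gE : g = \sum_a G.[z a] *: (gG a).1 + C`_0 *: lin_diff.
  apply: (mulfI psi_prod_neq0); rewrite gE0 mulrDr -scalerAr psi_prod_lin_diff -bdiffZ mulr_sumr.
  rewrite (eq_bigr (fun a => pdiff (G.[z a] *: (gG a).2))) => [|a _]; last first.
    by have [_ _ _ h] := gGP a; rewrite -scalerAr h bdiffZ.
  rewrite -mul_polyC -CE -HE.
  have <- : pdiff (\sum_a G.[z a] *: (gG a).2) = \sum_a pdiff (G.[z a] *: (gG a).2).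
    exact: linear_sum.
  by rewrite -bdiffD addrC /H subrK.
rewrite gE linearD linearZ /= xB [_ *: 0]scaler0 addr0 linear_sum big1 // => a _.
by have [_ _ h _] := gGP a; rewrite linearZ /= h scaler0.
Qed.

End Generic.
End Hypergeometric.

(** * R-matrices and orders of the indices *)

Section Rvec.
Variables (E : fieldType) (n : nat).

(** The R-matrix on the span of the v^(i), with coordinates in any module: it acts both on the
    scalars f_b and on the numerators of the eta_b, and linear functionals commute with it. *)
Definition Rvec (V : lmodType E) (a b : 'I_n) (u : E) (f : {ffun 'I_n -> V}) :
    {ffun 'I_n -> V} :=
  [ffun c => (u - 1)^-1 *: (u *: f c - f (tperm a b c))].

Lemma linear_Rvec (V W : lmodType E) (x : {linear V -> W}) a b u f :
  [ffun c => x (Rvec a b u f c)] = Rvec a b u [ffun c => x (f c)].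
Proof. by apply/ffunP => c; rewrite !ffunE linearZ linearB linearZ. Qed.

Lemma linear_foldr_Rvec (V W : lmodType E) (x : {linear V -> W}) a (u : 'I_n -> E) f s :
  [ffun c => x (foldr (fun j => Rvec a j (u j)) f s c)] =
  foldr (fun j => Rvec a j (u j)) [ffun c => x (f c)] s.
Proof.
elim: s => [|j s IH] //=; rewrite -IH -linear_Rvec.
by apply/ffunP => c; rewrite !ffunE.
Qed.

Lemma Rvec_neq (V : lmodType E) a b u (f : {ffun 'I_n -> V}) c :
  u != 1 -> c != a -> c != b -> Rvec a b u f c = f c.
Proof.
move=> u1 ca cb; rewrite ffunE tpermD 1?eq_sym // -{2}[f c]scale1r -scalerBl scalerA.
by rewrite mulVf ?scale1r // subr_eq0.
Qed.

(** As P^2 = 1, (u + P)(u - P) = u^2 - 1, which is nonzero for u different from 1 and -1. *)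
Lemma Rvec_inj (V : lmodType E) a b u : u != 1 -> u != -1 -> injective (@Rvec V a b u).
Proof.
move=> u1 uN1 f g /ffunP fg; apply/ffunP => c.
have u1' : (u - 1)^-1 != 0 by rewrite invr_eq0 subr_eq0.
have := fg (tperm a b c); have := fg c; rewrite !ffunE tpermK.
move=> /(scalerI u1') e1 /(scalerI u1') e2.
have uu : u * u - 1 != 0.
  by rewrite -[1]mulr1 subr_sqr mulf_neq0 // ?subr_eq0 // addr_eq0.
apply: (scalerI uu); rewrite !scalerBl !scale1r -!scalerA.
have := congr1 (fun v => u *: v) e1; rewrite !scalerBr => e3.
have := congr2 (fun v w => v + w) e3 e2.
by rewrite !addrA !subrK.
Qed.

Lemma foldr_Rvec_inj (V : lmodType E) a (u : 'I_n -> E) s :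
  (forall j, j \in s -> u j != 1 /\ u j != -1) ->
  injective (fun f : {ffun 'I_n -> V} => foldr (fun j => Rvec a j (u j)) f s).
Proof.
elim: s => [|j s IH] us f g //= e.
apply: IH => [i si|]; first by apply: us; rewrite inE si orbT.
by have [u1 uN1] := us j (mem_head _ _); exact: Rvec_inj e.
Qed.

End Rvec.

Section Orders.
Variables (E : fieldType) (n : nat) (z : 'I_n -> E).

(* The numerators over prod_j (t - z_j) of the functions eta_b attached to the
   order s of the indices. *)
Fixpoint numer (s : seq 'I_n) (b : 'I_n) : {poly E} :=
  if s is c :: s' then
    if c == b then \prod_(j <- s') ('X - (z j)%:P) else ('X - (z c)%:P + 1) * numer s' b
  else 0.

Definition numers s : {ffun 'I_n -> {poly E}} := [ffun b => numer s b].

Lemma numer_cat s t c : c \notin s ->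
  numer (s ++ t) c = \prod_(d <- s) ('X - (z d)%:P + 1) * numer t c.
Proof.
elim: s => [|d s IH]; first by rewrite big_nil mul1r.
by rewrite inE negb_or /= eq_sym => /andP[/negPf -> /IH ->]; rewrite big_cons mulrA.
Qed.

Lemma size_numer s b : (size (numer s b) <= size s)%N.
Proof.
elim: s => [|c s IH] /=; first by rewrite size_poly0.
case: eqP => _; first by rewrite size_prod_XsubC.
have -> : 'X - (z c)%:P + 1 = 'X - (z c - 1)%:P by rewrite polyCB opprB addrA addrAC.
by apply: leq_trans (size_polyMleq _ _) _; rewrite size_XsubC.
Qed.

(** At the two exchanged indices this reduces to the identities [key] and [key']; every other
    numerator is symmetric in the two neighbours. *)
Lemma numers_swap s1 s2 a b : uniq (s1 ++ a :: b :: s2) -> z a - z b != 1 ->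
  numers (s1 ++ b :: a :: s2) = Rvec a b (z a - z b) (numers (s1 ++ a :: b :: s2)).
Proof.
rewrite cat_uniq => /and3P[_ /hasPn s1P]; rewrite cons_uniq inE negb_or => /andP[/andP[ab _] _] u1.
have as1 : a \notin s1 by apply: s1P; rewrite mem_head.
have bs1 : b \notin s1 by apply: s1P; rewrite !inE eqxx orbT.
have ba : b == a = false by rewrite eq_sym (negPf ab).
have u1' : z a - z b - 1 != 0 by rewrite subr_eq0.
have key (h1 h2 x y t : {poly E}) :
    (x - y - 1) * (h1 * ((t - y + 1) * h2)) =
    (x - y) * (h1 * ((t - y) * h2)) - h1 * ((t - x + 1) * h2) by ring.
have key' (h1 h2 x y t : {poly E}) :
    (x - y - 1) * (h1 * ((t - x) * h2)) =
    (x - y) * (h1 * ((t - x + 1) * h2)) - h1 * ((t - y) * h2) by ring.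
apply/ffunP => c; have [->|ca] := eqVneq c a.
  rewrite !ffunE tpermL !numer_cat //= ba (negPf ab) !eqxx !big_cons.
  apply: (scalerI u1'); rewrite scalerA divff // scale1r -!mul_polyC !polyCB polyC1.
  exact: key.
have [->|cb] := eqVneq c b.
  rewrite !ffunE tpermR !numer_cat //= ba (negPf ab) !eqxx !big_cons.
  apply: (scalerI u1'); rewrite scalerA divff // scale1r -!mul_polyC !polyCB polyC1.
  exact: key'.
rewrite Rvec_neq // !ffunE; elim: s1 {as1 bs1 s1P} => [|d s1 IH] /=.
  by rewrite ![_ == c]eq_sym (negPf cb) (negPf ca) mulrCA.
rewrite IH; case: eqP => // _; apply: perm_big; rewrite perm_cat2l.
by rewrite -[b :: a :: s2]/([:: b] ++ [:: a] ++ s2) perm_catCA.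
Qed.

Lemma numers_move s1 t s2 a : uniq (s1 ++ a :: t ++ s2) ->
  (forall j, j \in t -> z a - z j != 1) ->
  numers (s1 ++ t ++ a :: s2) =
  foldr (fun j => Rvec a j (z a - z j)) (numers (s1 ++ a :: t ++ s2)) (rev t).
Proof.
elim: t s1 => [|b t IH] s1 //= us ut.
rewrite rev_cons foldr_rcons -numers_swap ?ut ?mem_head //.
rewrite -!(cat_rcons b s1); rewrite -(IH (rcons s1 b)) // => [|j jt]; last first.
  by rewrite ut // inE jt orbT.
rewrite cat_rcons (perm_uniq (_ : perm_eq _ (s1 ++ a :: b :: t ++ s2))) // perm_cat2l.
by rewrite -[b :: _]/([:: b] ++ [:: a] ++ t ++ s2) perm_catCA.
Qed.

(** Triangularity: if b is first in the order, only its own numerator is nonzero at z_b - 1, which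
    fixes its coefficient. The rest is divisible by t - z_b + 1, and the induction applies to the
    quotient. *)
Lemma numer_span (s : seq 'I_n) (g : {poly E}) :
  (forall i j, z i + 1 != z j) -> uniq s -> (size g <= size s)%N ->
  exists al : 'I_n -> E, g = \sum_(b <- s) al b *: numer s b.
Proof.
move=> z1; elim: s g => [|b s IH] g /=.
  by move=> _; rewrite leqn0 size_poly_eq0 => /eqP ->; exists (fun=> 0); rewrite big_nil.
case/andP=> bs us sg; pose D := \prod_(j <- s) ('X - (z j)%:P).
have Db : D.[z b - 1] != 0.
  rewrite horner_prod prodf_seq_neq0; apply/allP => j _ /=.
  by rewrite hornerXsubC subr_eq0 subr_eq eq_sym z1.
pose c := g.[z b - 1] / D.[z b - 1].
have : root (g - c *: D) (z b - 1).
  by rewrite /root hornerD hornerN hornerZ divfK // subrr.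
case/factor_theorem => g0 g0E.
have sg0 : (size g0 <= size s)%N.
  have [->|g0_neq0] := eqVneq g0 0; first by rewrite size_poly0.
  have : (size (g - c *: D)%R <= (size s).+1)%N.
    rewrite (leq_trans (size_polyD _ _)) // geq_max sg size_polyN.
    by rewrite (leq_trans (size_scale_leq _ _)) // size_prod_XsubC.
  by rewrite g0E size_Mmonic ?monicXsubC // size_XsubC addn2.
have [al alE] := IH g0 us sg0; exists (fun j => if j == b then c else al j).
rewrite big_cons !eqxx -[LHS](subrK (c *: D)) g0E addrC; congr (_ + _).
have -> : 'X - (z b - 1)%:P = 'X - (z b)%:P + 1 by rewrite polyCB opprB addrA addrAC.
rewrite {1}alE mulr_suml; apply: eq_big_seq => j js.
have -> : (j == b) = false by apply: contraNF bs => /eqP <-.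
have -> : (b == j) = false by apply: contraNF bs => /eqP ->.
by rewrite -scalerAl mulrC.
Qed.

Lemma sum_numer s : uniq s -> \sum_(b <- s) numer s b =
  \prod_(j <- s) ('X - (z j)%:P + 1) - \prod_(j <- s) ('X - (z j)%:P).
Proof.
elim: s => [|c s IH] /=; first by rewrite !big_nil subrr.
case/andP=> cs us; rewrite !big_cons eqxx.
rewrite [X in _ + X = _](eq_big_seq (fun b => ('X - (z c)%:P + 1) * numer s b)) => [|b bs].
  by rewrite -mulr_sumr IH //; ring.
by case: eqP => // e; rewrite e bs in cs.
Qed.

Lemma numer_sorted s b : sorted ltn [seq val i | i <- s] -> b \in s ->
  numer s b = \prod_(j <- s) (if (j < b)%N then 'X - (z j)%:P + 1
                              else if j == b then 1 else 'X - (z j)%:P).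
Proof.
elim: s => [|c s IH] //= ps; rewrite inE big_cons.
have lt_c j : j \in s -> (c < j)%N.
  by move=> js; move/(order_path_min ltn_trans)/allP: ps; apply; exact: map_f.
case: eqVneq => [->|bc] /= => [_|bs].
  rewrite ltnn mul1r; apply: eq_big_seq => j /lt_c cj.
  by rewrite ltnNge (ltnW cj) -val_eqE /= gtn_eqF.
by rewrite lt_c // IH // (path_sorted ps).
Qed.

End Orders.

Lemma enum_ord_sorted n : sorted ltn [seq val i | i <- enum 'I_n].
Proof. by rewrite val_enum_ord iota_ltn_sorted. Qed.

Lemma enum_ord_split n (a : 'I_n) :
  enum 'I_n = [seq j : 'I_n <- enum 'I_n | (j < a)%N] ++
              a :: [seq j : 'I_n <- enum 'I_n | (a < j)%N].
Proof.
have : a \in enum 'I_n by rewrite mem_enum.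
elim: (enum 'I_n) (enum_ord_sorted n) => [|c s IH] //= ps; rewrite inE.
have lt_c j : j \in s -> (c < j)%N.
  by move=> js; move/(order_path_min ltn_trans)/allP: ps; apply; exact: map_f.
case: eqVneq => [->|bc] /= => [_|bs].
  rewrite ltnn; have -> : [seq j <- s | (val j < val c)%N] = [::].
    apply/eqP; rewrite -[_ == _]negbK -has_filter; apply/hasPn => j /lt_c cj.
    by rewrite -leqNgt ltnW.
  by congr (_ :: _); apply/esym/all_filterP/allP => j /lt_c.
by rewrite lt_c // ltnNge (ltnW (lt_c _ bs)) /= -IH // (path_sorted ps).
Qed.

Section Pairing.
Variables (E : fieldType) (n : nat).

(** A functional is given by its values on the monomials t^i, so that a field morphism sigma acts on
    it as [sigma \o xi]. *)
Definition pairing (xi : 'I_n -> E) (g : {poly E}) : E^o := \sum_(i < n) xi i * g`_i.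

Fact pairing_is_linear xi : linear (pairing xi).
Proof.
move=> c g h; rewrite /pairing scaler_sumr -big_split; apply: eq_bigr => i _ /=.
by rewrite coefD coefZ mulrDr mulrCA.
Qed.
HB.instance Definition _ xi :=
  GRing.isLinear.Build E {poly E} E^o _ (pairing xi) (pairing_is_linear xi).

Lemma pairing_rmorph (tau : {rmorphism E -> E}) xi g :
  pairing (tau \o xi) (map_poly tau g) = tau (pairing xi g).
Proof. by rewrite rmorph_sum; apply: eq_bigr => i _; rewrite coef_map rmorphM. Qed.

(** By [numer_span] the coefficient matrix of the n numerators has an inverse, so their values can
    be prescribed. *)
Lemma pairing_exists (z : 'I_n -> E) (f : 'I_n -> E) :
  (forall i j, z i + 1 != z j) ->
  exists xi, forall b, pairing xi (numer z (enum 'I_n) b) = f b.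
Proof.
move=> z1; pose N := \matrix_(b, i) (numer z (enum 'I_n) b)`_(i : 'I_n) : 'M[E]_n.
have /fin_all_exists[Y YE] : forall i : 'I_n, exists al : {ffun 'I_n -> E},
    'X^i = \sum_b al b *: numer z (enum 'I_n) b.
  move=> i; have [|al alE] := numer_span (s := enum 'I_n) (g := 'X^i) z1 (enum_uniq _).
    by rewrite size_polyXn -cardE card_ord.
  exists [ffun b => al b]; rewrite [LHS]alE big_enum /=.
  by apply: eq_bigr => b _; rewrite ffunE.
have YN : (\matrix_(i, b) Y i b) *m N = 1%:M.
  apply/matrixP => i j; rewrite !mxE.
  transitivity ('X^i : {poly E})`_j; last by rewrite coefXn eq_sym.
  by rewrite YE coef_sum; apply: eq_bigr => b _; rewrite !mxE coefZ.
have [_ NU] := mulmx1_unit YN.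
exists (fun i => (invmx N *m (\col_b f b)) i 0) => b.
transitivity ((N *m (invmx N *m \col_b f b)) b 0); last by rewrite mulKVmx // mxE.
by rewrite [RHS]mxE; apply: eq_bigr => i _; rewrite [N b i]mxE mulrC.
Qed.

End Pairing.

(** * The functional of a solution *)

Lemma eq_in_foldr (T : eqType) (S : Type) (h h' : T -> S -> S) s x :
  {in s, h =1 h'} -> foldr h x s = foldr h' x s.
Proof.
elim: s => [|j s IH] //= e; rewrite IH => [|i si]; last by apply: e; rewrite inE si orbT.
by rewrite e // mem_head.
Qed.

Lemma map_numer (E : fieldType) (tau : {rmorphism E -> E}) n (z z' : 'I_n -> E) s b :
  tau \o z =1 z' -> map_poly tau (numer z s b) = numer z' s b.
Proof.
move=> zz'; elim: s => [|c s IH] /=; first by rewrite rmorph0.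
case: eqP => _; last by rewrite rmorphM rmorphD rmorph1 /= map_polyXsubC IH -zz'.
by rewrite rmorph_prod; apply: eq_bigr => j _; rewrite /= map_polyXsubC -zz'.
Qed.

Lemma map_pprod (E : fieldType) (tau : {rmorphism E -> E}) kappa z m :
  tau kappa = kappa -> map_poly tau (pprod kappa z m) = pprod kappa (tau z) m.
Proof.
move=> tk; rewrite rmorph_prod; apply: eq_bigr => i _.
by rewrite /= map_polyXsubC rmorphD rmorphMn /= tk.
Qed.

Section SolutionFunctional.
Variables (E : fieldType) (p k n : nat) (kappa : E).
Hypotheses (pchar : p \in [pchar E]) (kp : (k.+1 < p)%N).
Hypothesis kappak : kappa *+ k.+1 = -1.
Variable z : 'I_n -> E.
Hypothesis z_generic : forall i j m, i != j -> z i + kappa *+ m != z j.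

Local Notation pdiff := (bdiff kappa).
Local Notation phi z := (pprod kappa z k.+1).

Variable f : {ffun 'I_n -> E^o}.
Hypothesis f_V : \sum_b f b = 0.

Variables sigma tau : 'I_n -> {rmorphism E -> E}.
Hypothesis sigmaK : forall a, cancel (sigma a) (tau a).
Hypothesis tau_period : forall a x, iter p (tau a) x = x.
Hypothesis sigma_kappa : forall a, sigma a kappa = kappa.
Hypothesis sigma_z : forall a j, sigma a (z j) = z j - (if j == a then kappa else 0).
Hypothesis f_qKZ : forall a b, sigma a (f b) =
  foldr (fun j => Rvec a j (z a - z j - (if (j < a)%N then kappa else 0)))
    f (Kindices a) b.

Lemma tau_kappa a : tau a kappa = kappa.
Proof. by rewrite -{1}(sigma_kappa a) sigmaK. Qed.

Lemma tau_z a j : tau a (z j) = z j + (if j == a then kappa else 0).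
Proof.
have := congr1 (tau a) (sigma_z a j); rewrite sigmaK rmorphB /=.
by case: ifP => _; rewrite ?tau_kappa ?rmorph0 => e; rewrite [X in _ = X + _]e subrK.
Qed.

Lemma z_add1 i j : z i + 1 != z j.
Proof. exact: (z1_neq pchar kp kappak z_generic). Qed.

Lemma z_sub_neq i j m : i != j -> z i - z j != kappa *+ m.
Proof.
by rewrite eq_sym => ij; rewrite subr_eq addrC eq_sym z_generic.
Qed.

Lemma kappa_opp1 : kappa *+ (p - k.+1) = 1.
Proof. by rewrite mulrnBr ?(ltnW kp) // (mulrn_pchar pchar) kappak sub0r opprK. Qed.

(** The equation in z_a compares the two orders [a :: others a] and [others a ++ [:: a]]. *)
Let others (a : 'I_n) := [seq j : 'I_n <- enum 'I_n | (j < a)%N] ++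
              [seq j : 'I_n <- enum 'I_n | (a < j)%N].

Lemma others_perm a : perm_eq (enum 'I_n) (a :: others a).
Proof. by rewrite {1}(enum_ord_split a) perm_catC /= perm_cons perm_catC. Qed.

Lemma others_uniq a : uniq (a :: others a).
Proof. by rewrite -(perm_uniq (others_perm a)) enum_uniq. Qed.

Lemma mem_others a j : (j \in others a) = (j != a).
Proof.
rewrite mem_cat !(mem_filter _ _ (enum 'I_n)) !mem_enum !andbT -val_eqE /=.
by case: ltngtP.
Qed.

Lemma size_others a : (size (others a)).+1 = n.
Proof. by have /perm_size := others_perm a; rewrite /= -cardE card_ord. Qed.

Lemma prod_others a (F : 'I_n -> {poly E}) : \prod_(j <- others a) F j = \prod_(j | j != a) F j.
Proof.
have := others_uniq a => /= /andP[_ uo].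
by rewrite big_uniq //=; apply: eq_bigl => j; rewrite mem_others.
Qed.

Variable xi : 'I_n -> E.
Hypothesis xiE : forall b, pairing xi (numer z (enum 'I_n) b) = f b.

(** K_a consists of two chains of exchanges. The one over j > a carries a from its natural place to
    the last; the one over j < a, at the shifted z, carries it from the first place to its natural
    one. The latter is injective and cancels from the qKZ equation. *)
Lemma pairing_last_first a b :
  pairing (sigma a \o xi) (numer (sigma a \o z) (a :: others a) b) =
  pairing xi (numer z (others a ++ [:: a]) b).
Proof.
set s1 := [seq j : 'I_n <- enum 'I_n | (j < a)%N].
set s2 := [seq j : 'I_n <- enum 'I_n | (a < j)%N].
have enumE : enum 'I_n = s1 ++ a :: s2 := enum_ord_split a.
have uo := others_uniq a; rewrite /others -/s1 -/s2 in uo *.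
have ja j : j \in s1 ++ s2 -> j != a by rewrite -mem_others.
have inner : foldr (fun j => Rvec a j (z a - z j)) f (rev s2) =
    [ffun b => pairing xi (numers z (s1 ++ s2 ++ [:: a]) b)].
  rewrite (numers_move (s2 := [::])); first last.
  - move=> j js; rewrite -kappa_opp1 z_sub_neq // eq_sym ja // mem_cat js orbT //.
  - by rewrite cats0 -enumE enum_uniq.
  rewrite linear_foldr_Rvec cats0 -enumE; congr (foldr _ _ _).
  by apply/ffunP => c; rewrite /numers !ffunE /= xiE.
have outer : [ffun b => sigma a (f b) : E^o] =
    foldr (fun j => Rvec a j (sigma a (z a) - sigma a (z j)))
      [ffun b => pairing (sigma a \o xi) (numers (sigma a \o z) (a :: s1 ++ s2) b)] (rev s1).
  rewrite -linear_foldr_Rvec -(numers_move (z := sigma a \o z) (s1 := [::])) //.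
    apply/ffunP => c; rewrite !ffunE -xiE -pairing_rmorph.
    by rewrite enumE (map_numer (z' := sigma a \o z)).
  move=> j js; rewrite /= !sigma_z eqxx.
  have /negPf jna : j != a by rewrite ja // mem_cat js.
  rewrite jna subr0 addrAC subr_eq -kappa_opp1 -mulrSr z_sub_neq // eq_sym jna //.
have K1 : [ffun b => sigma a (f b) : E^o] =
    foldr (fun j => Rvec a j (sigma a (z a) - sigma a (z j)))
      (foldr (fun j => Rvec a j (z a - z j)) f (rev s2)) (rev s1).
  apply/ffunP => c; rewrite ffunE f_qKZ /Kindices -/s1 -/s2 foldr_cat.
  congr (fun_of_fin _ c); rewrite (eq_in_foldr (s := rev s2) (h' := fun j => Rvec a j (z a - z j))).
    apply: eq_in_foldr => j; rewrite mem_rev (mem_filter _ _ (enum 'I_n)) => /andP[js _].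
    rewrite js !sigma_z eqxx; have -> : (j == a) = false by rewrite -val_eqE ltn_eqF.
    by rewrite subr0 addrAC.
  move=> j; rewrite mem_rev (mem_filter _ _ (enum 'I_n)) => /andP[js _].
  by rewrite ltnNge (ltnW js) /= subr0.
have /ffunP/(_ b) : [ffun b => pairing (sigma a \o xi) (numers (sigma a \o z) (a :: s1 ++ s2) b)] =
    [ffun b => pairing xi (numers z (s1 ++ s2 ++ [:: a]) b)].
  apply: (@foldr_Rvec_inj _ _ _ a (fun j => sigma a (z a) - sigma a (z j)) (rev s1)); last first.
    by rewrite -outer -inner.
  move=> j; rewrite mem_rev => js; have aj : j != a by rewrite ja // mem_cat js.
  (* Both 1 and -1 are multiples of [kappa], namely by p - (k + 1) and k + 1, so genericity excludes
     them as arguments of the R-matrices. *)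
  have neq m : z a - kappa - z j != kappa *+ m.
    by rewrite addrAC subr_eq -mulrSr z_sub_neq // eq_sym.
  rewrite !sigma_z eqxx (negPf aj) subr0; split; first by rewrite -kappa_opp1.
  by rewrite -kappak.
by rewrite !ffunE -catA.
Qed.

Lemma map_lin_off a (t : 'I_n -> {rmorphism E -> E}) :
  (forall j, j != a -> t a (z j) = z j) -> map_poly (t a) (lin_off z a) = lin_off z a.
Proof.
move=> tz; rewrite rmorph_prod; apply: eq_bigr => j ja.
by rewrite /= map_polyXsubC tz.
Qed.

Lemma map_lin1_off a (t : 'I_n -> {rmorphism E -> E}) :
  (forall j, j != a -> t a (z j) = z j) -> map_poly (t a) (lin1_off z a) = lin1_off z a.
Proof.
move=> tz; rewrite rmorph_prod; apply: eq_bigr => j ja.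
by rewrite /= rmorphD rmorph1 /= map_polyXsubC tz.
Qed.

Lemma sigma_others a j : j != a -> sigma a (z j) = z j.
Proof. by move=> /negPf ja; rewrite sigma_z ja subr0. Qed.

Lemma tau_others a j : j != a -> tau a (z j) = z j.
Proof. by move=> /negPf ja; rewrite tau_z ja addr0. Qed.

Lemma pairing_lin_off a : pairing (sigma a \o xi) (lin_off z a) = pairing xi (lin1_off z a).
Proof.
have := pairing_last_first a a; rewrite numer_cat; last by rewrite mem_others eqxx.
rewrite /= !eqxx big_nil mulr1 !prod_others => <-; congr (pairing _ _).
by apply: eq_bigr => j ja; rewrite /= sigma_others.
Qed.

(** The case b <> a of [pairing_last_first]: a contributes t - z_a + 1 with shifted z_a when first,
    and t - z_a when last. The numerators of the n - 1 other indices span all g in question. *)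
Lemma pairing_shift a (g : {poly E}) : (size g < n)%N ->
  pairing (sigma a \o xi) (('X - (z a - kappa)%:P + 1) * g) =
  pairing xi (('X - (z a)%:P) * g).
Proof.
move=> sg; have [_ uo] := andP (others_uniq a).
have [|al ->] := numer_span (g := g) z_add1 uo; first by rewrite -ltnS size_others.
rewrite !mulr_sumr !linear_sum; apply: eq_big_seq => b; rewrite mem_others => ba.
rewrite -!scalerAr !linearZ /=; congr (_ *: _).
have := pairing_last_first a b.
have nab : (a == b) = false by rewrite eq_sym (negPf ba).
have -> : numer z (others a ++ [:: a]) b = ('X - (z a)%:P) * numer z (others a) b.
  have bo : b \in others a by rewrite mem_others.
  have ao : a \notin others a by rewrite mem_others eqxx.
  elim: (others a) uo bo ao => [|c s IH] //=; rewrite !inE negb_or.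
  move=> /andP[cs us] bs /andP[ac as_]; have [_|cb] := eqVneq c b.
    by rewrite big_cat big_seq1 /= mulrC.
  move: bs; rewrite eq_sym (negPf cb) => bs.
  by rewrite IH // mulrCA.
move=> <-; rewrite /= nab sigma_z eqxx; congr (pairing _ (_ * _)).
have ao : a \notin others a by rewrite mem_others eqxx.
elim: (others a) ao => [|c s IH] //=; rewrite inE negb_or eq_sym => /andP[ca as_].
rewrite -IH // sigma_others //; case: eqP => // _.
apply: eq_big_seq => j js; rewrite sigma_others //.
by apply: contraNneq as_ => <-.
Qed.

Lemma pairing_lin_diff : pairing xi (lin_diff z) = 0.
Proof.
have -> : lin_diff z = \sum_b numer z (enum 'I_n) b.
  by rewrite /lin_diff -!big_enum /= -sum_numer ?enum_uniq // big_enum.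
by rewrite linear_sum /= (eq_bigr f) // => b _; rewrite xiE.
Qed.

Lemma pairing_relation a :
  pairing xi (lin1_off z a + ('X - (z a)%:P) * (lin1_off z a - lin_off z a)) = 0.
Proof.
rewrite -[RHS]pairing_lin_diff; congr (pairing _ _).
by rewrite /lin_diff [\prod_j (_ - _ + 1)](bigD1 a) //=
  [\prod_j (_ - _)](bigD1 a) //= -/(lin_off z a) -/(lin1_off z a); ring.
Qed.

Lemma pairing_eq (eta eta' : 'I_n -> E) g : eta =1 eta' -> pairing eta g = pairing eta' g.
Proof. by move=> e; apply: eq_bigr => i _; rewrite e. Qed.

Lemma map_XsubC1 (t : {rmorphism E -> E}) v g :
  map_poly t (('X - v%:P + 1) * g) = ('X - (t v)%:P + 1) * map_poly t g.
Proof. by rewrite rmorphM rmorphD rmorph1 /= map_polyXsubC. Qed.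

Lemma map_XsubC (t : {rmorphism E -> E}) v g :
  map_poly t (('X - v%:P) * g) = ('X - (t v)%:P) * map_poly t g.
Proof. by rewrite rmorphM /= map_polyXsubC. Qed.

Lemma map_tauK a (g : {poly E}) : map_poly (tau a) (map_poly (sigma a) g) = g.
Proof.
rewrite -map_poly_comp; apply/polyP => i; rewrite coef_map_id0 /= ?rmorph0 //.
exact: sigmaK.
Qed.

Definition orbit a m : 'I_n -> E := iter m (fun eta => tau a \o eta) xi.

(** Applying [tau a] moves the relations between [sigma a \o xi] and [xi] along the orbit; [lin_off]
    and [lin1_off] do not involve z_a and stay fixed. *)
Lemma orbit_relations a m :
  [/\ forall g : {poly E}, (size g < n)%N ->
        pairing (orbit a m) (('X - (z a + kappa *+ m)%:P + 1) * g) =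
        pairing (orbit a m.+1) (('X - (z a + kappa *+ m.+1)%:P) * g),
      pairing (orbit a m) (lin_off z a) = pairing (orbit a m.+1) (lin1_off z a) &
      pairing (orbit a m.+1) (lin1_off z a +
        ('X - (z a + kappa *+ m.+1)%:P) * (lin1_off z a - lin_off z a)) = 0].
Proof.
have tau_v i : tau a (z a + kappa *+ i) = z a + kappa *+ i.+1.
  by rewrite rmorphD rmorphMn /= tau_z tau_kappa eqxx mulrS addrA.
have ts g : pairing xi g = pairing (tau a \o (sigma a \o xi)) g.
  by apply: pairing_eq => i; rewrite /= sigmaK.
have tD := map_lin_off (@tau_others a); have tA := map_lin1_off (@tau_others a).
elim: m => [|m [R1 R2 R3]]; split.
- move=> g sg; rewrite ts mulr0n addr0 -(map_tauK a g).
  have -> : z a = tau a (z a - kappa) by rewrite rmorphB /= tau_z tau_kappa eqxx addrK.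
  rewrite -map_XsubC1 pairing_rmorph pairing_shift ?size_map_poly // -pairing_rmorph.
  rewrite map_XsubC -[in LHS](addr0 (z a)) -(mulr0n kappa) tau_v.
  by rewrite rmorphB /= tau_z tau_kappa eqxx addrK.
- by rewrite ts -[in LHS]tD pairing_rmorph pairing_lin_off -pairing_rmorph tA.
- rewrite -(tau_v 0) -{1}tA -{2}tA -tD -rmorphB /= -map_XsubC -rmorphD.
  by rewrite pairing_rmorph mulr0n addr0 pairing_relation rmorph0.
- move=> g sg; rewrite -(map_tauK a g) -(tau_v m) -(tau_v m.+1) -map_XsubC1 -map_XsubC !pairing_rmorph.
  by apply: (congr1 (tau a)); apply: R1; rewrite size_map_poly.
- by rewrite -[in LHS]tD -tA !pairing_rmorph R2.
- rewrite -tau_v -{1}tA -{2}tA -tD -rmorphB /= -map_XsubC -rmorphD.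
  by rewrite pairing_rmorph R3 rmorph0.
Qed.

Hypothesis pnk : (p <= n * k.+1)%N.

Lemma pairing_coboundary (g G : {poly E}) : (0 < n)%N -> (size g <= n)%N ->
  psi_prod k kappa z * g = pdiff G -> pairing xi g = 0.
Proof.
move=> n_gt0; apply: (coboundary_eq0 pchar kp kappak z_generic) => // [|a].
  exact: pairing_lin_diff.
have [q sq mass] := unit_mass pchar kp kappak z_generic a pnk.
apply: (p_curvature pchar kappak z_generic (y := fun m => pairing (orbit a m)) _ _ _ _ sq mass).
- by move=> m h sh; have [R1 _ _] := orbit_relations a m; exact: R1.
- by move=> m; have [_ R2 _] := orbit_relations a m.
- by move=> m; have [_ _ R3] := orbit_relations a m.
move=> h; apply: pairing_eq => i; rewrite /orbit -[RHS](tau_period a).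
by elim: (p) => //= m ->.
Qed.

(** By [pairing_coboundary] the value depends only on the class of P. Represent it by (t - z_a) q,
    apply [sigma a], and carry the result from z_a - [kappa] back to z_a by [transport_step]: this
    again represents P modulo coboundaries. *)
Lemma pairing_invariant a (P g G : {poly E}) : (size P <= n * k.+1)%N ->
  map_poly (sigma a) P = P -> (size g <= n)%N ->
  psi_prod k kappa z * g = P + pdiff G -> sigma a (pairing xi g) = pairing xi g.
Proof.
move=> sP Pinv sg gE; have n_gt0 : (0 < n)%N by rewrite -(size_others a).
have pairing_uniq (h H : {poly E}) : (size h <= n)%N ->
    psi_prod k kappa z * h = P + pdiff H -> pairing xi h = pairing xi g.
  move=> sh hE; apply/eqP; rewrite -subr_eq0 -linearB; apply/eqP.
  apply: (pairing_coboundary (G := H - G)) => //.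
    by rewrite (leq_trans (size_polyD _ _)) // geq_max sh size_polyN.
  by rewrite mulrBr hE gE linearB opprD addrACA subrr add0r.
have sXM (h : {poly E}) v : (size h < n)%N -> (size (('X - v%:P) * h)%R <= n)%N.
  have [->|h0] := eqVneq h 0; first by rewrite mulr0 size_poly0.
  by rewrite mulrC size_Mmonic ?monicXsubC // size_XsubC addn2.
have [q [H [sq qE]]] := psi_prod_mod_bdiff_at pchar kp kappak z_generic a sP.
have sigv : sigma a (z a) = z a - kappa by rewrite sigma_z eqxx.
rewrite -(pairing_uniq _ _ (sXM q (z a) sq) qE) -pairing_rmorph map_XsubC sigv.
have Dv : (lin_off z a).[z a - kappa - 1] != 0.
  have -> : z a - kappa - 1 = z a + kappa *+ k.
    by rewrite -kappak mulrS addrA subrK.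
  exact: lin_off_neq0.
have [|||c [q1 [sq1 xE q1E]]] := transport_step kappak (x := pairing (sigma a \o xi))
  (x' := pairing xi) (q := map_poly (sigma a) q) Dv _ (pairing_lin_off a).
- by move=> h sh; rewrite subrK /= pairing_shift.
- by rewrite subrK /= pairing_relation.
- by rewrite size_map_poly.
rewrite xE subrK; apply: etrans (pairing_uniq _
  (map_poly (sigma a) H + c *: (phi (z a - kappa) * phi_off k kappa z a)) (sXM _ _ sq1) _) _;
  last first.
  by rewrite (pairing_uniq _ _ (sXM q (z a) sq) qE).
have mapPsi_off : map_poly (sigma a) (psi_off k kappa z a) = psi_off k kappa z a.
  rewrite rmorph_prod; apply: eq_bigr => j ja.
  by rewrite /= map_pprod ?rmorphD /= ?sigma_others ?sigma_kappa.
rewrite subrK in q1E; rewrite -phi_psi_offE q1E -sigv -map_pprod // -{1}mapPsi_off -!rmorphM /=.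
rewrite phi_psi_offE qE [map_poly _ (P + _)]rmorphD /= Pinv bdiffD bdiffZ -addrA; congr (_ + (_ + _)).
rewrite /bdiff rmorphB /= map_comp_poly rmorphB /= map_polyX map_polyC.
by rewrite /= sigma_kappa.
Qed.

End SolutionFunctional.

Lemma poch_sum_mod_bdiff (E : fieldType) (p k : nat) (kappa : E) (C : nat -> E) M :
  p \in [pchar E] -> kappa *+ k.+1 = -1 ->
  exists G : {poly E}, \sum_(i < M) C i *: poch 'X kappa%:P i =
    \sum_(1 <= l < (M %/ p).+1) C (l * p).-1 *: poch 'X kappa%:P (l * p).-1 + bdiff kappa G.
Proof.
move=> pchar kappak; have p_gt0 := prime_gt0 (pcharf_prime pchar).
elim: M => [|M [G IH]]; first by exists 0; rewrite div0n big_ord0 big_geq // linear0 addr0.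
(* The range of l grows exactly when p divides M + 1, and then M is l p - 1 for the new l. *)
rewrite big_ord_recr /= IH divnS //; have [pM|pM] := boolP (p %| M.+1)%N.
  have e : ((M %/ p).+1 * p = M.+1)%N by rewrite -[RHS](divnK pM) divnS // pM.
  by exists G; rewrite add1n [in RHS]big_nat_recr //= e addrAC.
have [H HE] := poch_bdiff pchar kappak pM.
by exists (G + C M *: H); rewrite add0n HE bdiffD bdiffZ -addrA.
Qed.

(** * Expansion of a solution in the classes of (t; kappa)_(l p - 1) *)

Section Combination.
Variables (E : fieldType) (p k n : nat) (kappa : E).
Hypotheses (pchar : p \in [pchar E]) (kp : (k.+1 < p)%N).
Hypothesis kappak : kappa *+ k.+1 = -1.
Variable z : 'I_n -> E.
Hypothesis z_generic : forall i j m, i != j -> z i + kappa *+ m != z j.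
Variable f : {ffun 'I_n -> E^o}.
Hypothesis f_V : \sum_b f b = 0.
Variables sigma tau : 'I_n -> {rmorphism E -> E}.
Hypothesis sigmaK : forall a, cancel (sigma a) (tau a).
Hypothesis tau_period : forall a x, iter p (tau a) x = x.
Hypothesis sigma_kappa : forall a, sigma a kappa = kappa.
Hypothesis sigma_z : forall a j, sigma a (z j) = z j - (if j == a then kappa else 0).
Hypothesis f_qKZ : forall a b, sigma a (f b) =
  foldr (fun j => Rvec a j (z a - z j - (if (j < a)%N then kappa else 0)))
    f (Kindices a) b.
Hypothesis pnk : (p <= n * k.+1)%N.

(** The coefficient [c l] is the value of the functional at a [g] representing (t; kappa)_(l p - 1),
    a polynomial fixed by every shift. Expanding the class of [psi_prod] times the numerator of
    eta_b in these representatives gives f_b. *)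
Lemma qKZ_combination (C : nat -> 'I_n -> E) :
  (forall b, psi_prod k kappa z * numer z (enum 'I_n) b =
     \sum_(i < n * k.+1) C i b *: poch 'X kappa%:P i) ->
  exists c : nat -> E, (forall a l, sigma a (c l) = c l) /\
    forall b, f b = \sum_(1 <= l < ((n * k.+1) %/ p).+1) c l * C (l * p).-1 b.
Proof.
move=> CE; have p_gt0 := prime_gt0 (pcharf_prime pchar).
have n_gt0 : (0 < n)%N by case: n pnk => //; rewrite mul0n leqn0; case: p p_gt0.
set d := ((n * k.+1) %/ p)%N.
have [xi xiE] := pairing_exists f (z1_neq pchar kp kappak z_generic).
(* At l = 0 the truncated predecessor gives degree 0, hence a separate case in the bound; the sums
   start at l = 1. *)
have sP (l : 'I_d.+1) : (size (poch 'X (kappa%:P) (l * p).-1) <= n * k.+1)%N.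
  have : (l * p <= n * k.+1)%N.
    by apply: leq_trans (leq_divM (n * k.+1) p); rewrite leq_mul2r -ltnS ltn_ord orbT.
  by rewrite size_poch; case: (l * p)%N => [_|m //]; exact: leq_trans p_gt0 pnk.
have /fin_all_exists2[g gs /fin_all_exists[G gE]] : forall l : 'I_d.+1,
    exists2 g : {poly E}, (size g <= n)%N &
      exists G, psi_prod k kappa z * g = poch 'X kappa%:P (l * p).-1 + bdiff kappa G.
  move=> l; have [g [G [sg gE]]] := psi_prod_mod_bdiff pchar kp kappak z_generic n_gt0 (sP l).
  by exists g => //; exists G.
exists (fun l => pairing xi (g (inord l))); split=> [a l|b].
  apply: (pairing_invariant pchar kp kappak z_generic f_V sigmaK tau_period sigma_kappa
    sigma_z f_qKZ xiE pnk (sP (inord l)) _ (gs _) (gE _)).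
  by rewrite (rmorph_poch (map_poly _)) /= map_polyX map_polyC /= sigma_kappa.
have [H HE] := poch_sum_mod_bdiff (C^~ b) (n * k.+1) pchar kappak.
rewrite -CE -/d in HE.
pose h := numer z (enum 'I_n) b - \sum_(1 <= l < d.+1) C (l * p).-1 b *: g (inord l).
have h0 : pairing xi h = 0.
  apply: (pairing_coboundary pchar kp kappak z_generic f_V sigmaK tau_period sigma_kappa
    sigma_z f_qKZ xiE pnk (G := H - \sum_(1 <= l < d.+1) C (l * p).-1 b *: G (inord l)) n_gt0).
    rewrite (leq_trans (size_polyD _ _)) // geq_max size_polyN; apply/andP; split.
      by rewrite (leq_trans (size_numer _ _ _)) // -cardE card_ord.
    apply: leq_trans (size_sum _ _ _) _; apply/bigmax_leqP_seq => l _ _.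
    exact: leq_trans (size_scale_leq _ _) (gs _).
  rewrite mulrBr HE.
  have -> : psi_prod k kappa z * \sum_(1 <= l < d.+1) C (l * p).-1 b *: g (inord l) =
      \sum_(1 <= l < d.+1) C (l * p).-1 b *: poch 'X kappa%:P (l * p).-1 +
      bdiff kappa (\sum_(1 <= l < d.+1) C (l * p).-1 b *: G (inord l)).
    rewrite linear_sum -big_split mulr_sumr; apply: eq_big_nat => l /andP[_ ld].
    by rewrite -scalerAr gE inordK // scalerDr /= bdiffZ.
  by rewrite opprD addrACA subrr add0r; apply/esym; exact: linearB.
move/eqP: h0; rewrite linearB subr_eq0 /= xiE => /eqP ->.
rewrite linear_sum; apply: eq_bigr => l _.
by rewrite linearZ /= mulrC.
Qed.

End Combination.

(** * Shifts of rational functions, tensors *)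

Section Shift.
Variables (K : fieldType) (n : nat).
Local Notation P := {mpoly K[n]}.
Local Notation F := (ratfun K n).

Lemma ratfunP (x : F) : exists u v : P, v != 0 /\ x = u%:F / v%:F.
Proof.
set r := repr x; have d0 : \d_r != 0 by exact: denom_ratioP.
exists (\n_r), (\d_r); split=> //; apply/esym.
rewrite -[RHS]reprK -/r; apply: (@mulIf _ (\d_r)%:F); first by rewrite tofrac_eq0.
rewrite divfK ?tofrac_eq0 //; unlock FracField.tofrac.
rewrite -[RHS]FracField.pi_mul; apply/eqmodP => /=.
rewrite FracField.equivfE /FracField.mulf.
by rewrite !numden_Ratio ?mulf_neq0 ?oner_neq0 // !mulr1 mul1r mulrC.
Qed.

Lemma comp_mpolyA (q : P) (h h' : n.-tuple P) :
  (q \mPo h) \mPo h' = q \mPo [tuple tnth h i \mPo h' | i < n].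
Proof.
rewrite [X in X \mPo h']comp_mpolyE [RHS]comp_mpolyE raddf_sum /=.
apply: eq_bigr => m _; rewrite comp_mpolyZ rmorph_prod /=; congr (_ *: _).
by apply: eq_bigr => i _; rewrite rmorphXn /= tnth_mktuple.
Qed.

Definition translation (e : 'I_n -> K) : n.-tuple P := [tuple 'X_i - (e i)%:MP | i < n].

Lemma translationD e e' (q : P) :
  (q \mPo translation e) \mPo translation e' = q \mPo translation (fun i => e i + e' i).
Proof.
rewrite comp_mpolyA; congr (_ \mPo _); apply: eq_from_tnth => i; rewrite !tnth_mktuple.
rewrite comp_mpolyB comp_mpolyXU -tnth_nth tnth_mktuple comp_mpolyC.
by rewrite mpolyCD opprD -addrA [- _ + - _]addrC.
Qed.

Lemma translation0 e (q : P) : (forall i, e i = 0) -> q \mPo translation e = q.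
Proof.
move=> e0; rewrite -[RHS]comp_mpoly_id; congr (_ \mPo _).
by apply: eq_from_tnth => i; rewrite !tnth_mktuple e0 mpolyC0 subr0.
Qed.

Lemma eq_translation e e' : e =1 e' -> translation e = translation e'.
Proof. by move=> ee'; apply: eq_from_tnth => i; rewrite !tnth_mktuple ee'. Qed.

Lemma shift_tupleE a kappa :
  shift_tuple a kappa = translation (fun i => if i == a then kappa else 0).
Proof.
by apply: eq_from_tnth => i; rewrite !tnth_mktuple; case: eqP; rewrite ?mpolyC0.
Qed.

Section Morphism.
Variables (a : 'I_n) (kappa : K).

Lemma shift_tofrac (u : P) : shift a kappa u%:F = (u \mPo shift_tuple a kappa)%:F.
Proof.
have := shiftE a kappa u (oner_neq0 _).
by rewrite comp_mpoly1 !rmorph1 !divr1.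
Qed.

Lemma comp_shift_neq0 (v : P) : v != 0 -> (v \mPo shift_tuple a kappa)%:F != 0 :> F.
Proof.
apply: contra_neq => /eqP; rewrite tofrac_eq0 => /eqP e.
by apply: (@shift_tuple_inj _ _ a kappa); rewrite e comp_mpoly0.
Qed.

Fact shift_is_zmod_morphism : zmod_morphism (shift a kappa : F -> F).
Proof.
move=> x y; have [u [v [v0 ->]]] := ratfunP x; have [u' [v' [v'0 ->]]] := ratfunP y.
rewrite -mulNr addf_div ?tofrac_eq0 // -!rmorphN -!rmorphM -rmorphD.
rewrite !shiftE ?mulf_neq0 // -mulNr addf_div ?comp_shift_neq0 //.
by rewrite comp_mpolyD !(rmorphM (comp_mpoly _)) /= ?comp_mpolyN !rmorphD !rmorphM /= ?rmorphN ?mulNr.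
Qed.

Fact shift_is_monoid_morphism : monoid_morphism (shift a kappa : F -> F).
Proof.
split=> [|x y]; first by rewrite -[1](rmorph1 (@FracField.tofrac _)) shift_tofrac comp_mpoly1.
have [u [v [v0 ->]]] := ratfunP x; have [u' [v' [v'0 ->]]] := ratfunP y.
rewrite mulf_div -!rmorphM /= !shiftE ?mulf_neq0 // mulf_div.
by rewrite !rmorphM.
Qed.

HB.instance Definition _ :=
  GRing.isZmodMorphism.Build F F (shift a kappa) shift_is_zmod_morphism.
HB.instance Definition _ :=
  GRing.isMonoidMorphism.Build F F (shift a kappa) shift_is_monoid_morphism.
End Morphism.

Lemma shift_zvar (a : 'I_n) kappa (j : 'I_n) :
  shift a kappa (zvar K j) = zvar K j - (if j == a then (kappa%:MP)%:F else 0).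
Proof.
rewrite /zvar shift_tofrac comp_mpolyXU -tnth_nth tnth_mktuple rmorphB /=.
by case: ifP; rewrite ?rmorph0.
Qed.

Lemma shift_const a kappa c : shift a kappa (c%:MP)%:F = (c%:MP)%:F :> F.
Proof. by rewrite shift_tofrac comp_mpolyC. Qed.

Lemma iter_shift_tofrac a kappa m (u : P) : iter m (shift a kappa) u%:F =
  (u \mPo translation (fun i => if i == a then kappa *+ m else 0))%:F.
Proof.
elim: m => [|m IH].
  by rewrite translation0 // => i; case: ifP.
rewrite iterS IH shift_tofrac shift_tupleE translationD; congr (_ \mPo _)%:F.
apply: eq_translation => i; case: ifP; rewrite ?addr0 // mulrSr.
by [].
Qed.

Lemma iter_shift a kappa m (x : F) : kappa *+ m = 0 -> iter m (shift a kappa) x = x.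
Proof.
move=> km; have [u [v [v0 ->]]] := ratfunP x.
have iterV (y y' : F) i : iter i (shift a kappa) (y / y') =
    iter i (shift a kappa) y / iter i (shift a kappa) y'.
  by elim: i => [//|i IH]; rewrite !iterS IH fmorph_div.
rewrite iterV !iter_shift_tofrac km.
by rewrite !translation0 // => i; case: ifP.
Qed.

Lemma shiftK a kappa : cancel (shift a kappa : F -> F) (shift a (- kappa)).
Proof.
move=> x; have [u [v [v0 ->]]] := ratfunP x.
have shift_div k (y y' : F) : shift a k (y / y') = shift a k y / shift a k y'.
  exact: fmorph_div.
rewrite (shift_div _ u%:F) !shift_tofrac (shift_div _ (_ \mPo _)%:F) !shift_tofrac.
rewrite !shift_tupleE !translationD !translation0 // => i;
  by case: ifP => _; rewrite ?addr0 ?subrr.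
Qed.

End Shift.

(** * The operators K_a on the span of the v^(i) *)

Section Tensors.
Variables (K : fieldType) (n : nat).
Local Notation F := (ratfun K n).

Definition embedf (g : {ffun 'I_n -> F^o}) : tensors K n := embed (\col_i g i).

Lemma embedfE g s : embedf g s = \sum_i g i * (s == [ffun l => l == i])%:R.
Proof.
rewrite /embedf /embed sum_ffunE; apply: eq_bigr => i _.
by rewrite !ffunE mxE.
Qed.

Lemma embedf_inj : injective embedf.
Proof.
have E g i : embedf g [ffun l => l == i] = g i.
  rewrite embedfE (bigD1 i) //= eqxx mulr1 big1 ?addr0 // => j ji.
  case: eqP => [/ffunP/(_ j)|_]; last by rewrite mulr0.
  by rewrite !ffunE eqxx (negPf ji).
by move=> g h gh; apply/ffunP => i; rewrite -!E gh.
Qed.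

(** Exchanging two tensor factors permutes the v^(c) by the transposition of i and j, so reindexing
    the sum moves it to the coordinates. *)
Lemma permP_embedf i j g :
  Defs.permP i j (embedf g) = embedf [ffun c => g (tperm i j c)].
Proof.
apply/ffunP => s; rewrite ffunE !embedfE (reindex_inj (@perm_inj _ (tperm i j))) /=.
apply: eq_bigr => c _; rewrite ffunE; congr (_ * (_ : bool)%:R).
apply/eqP/eqP => /ffunP e; apply/ffunP => l; rewrite !ffunE.
  by have := e (tperm i j l); rewrite !ffunE tpermK (inj_eq perm_inj).
by rewrite e ffunE -(inj_eq (@perm_inj _ (tperm i j))) tpermK.
Qed.

Lemma Rmat_embedf i j u g : Rmat i j u (embedf g) = embedf (Rvec i j u g).
Proof.
apply/ffunP => s; rewrite /Rmat permP_embedf !ffunE !embedfE.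
rewrite [LHS]scalerBr !scaler_sumr -sumrB; apply: eq_bigr => c _; rewrite !ffunE.
by rewrite /GRing.scale /= mulrBr !mulrA mulrBl -!mulrA.
Qed.

Lemma Kop_embedf a kappa g : Kop a kappa (embedf g) =
  embedf (foldr (fun j => Rvec a j
     (zvar K a - zvar K j - (if (j < a)%N then (kappa%:MP)%:F else 0))) g (Kindices a)).
Proof. by rewrite /Kop; elim: (Kindices a) => //= j s ->; rewrite Rmat_embedf. Qed.

End Tensors.

(** * Invariant rational functions *)

Section Invariants.
Variables (K : fieldType) (n p k : nat) (kappa : K).
Hypotheses (pchar : p \in [pchar K]) (kp : (k.+1 < p)%N).
Hypothesis kappak : kappa *+ k.+1 = -1.
Local Notation P := {mpoly K[n]}.
Local Notation AS := (artin_schreier_tuple K n p).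

Let p_gt0 : (0 < p)%N. Proof. exact: prime_gt0 (pcharf_prime pchar). Qed.

(* The sum is invariant under the p translations by F_p and its degree is less
   than p. *)
Lemma sum_translates_const (h : {poly K}) : (size h <= p)%N ->
  \sum_(j < p) (h \Po ('X + (kappa *+ j)%:P)) = (\sum_(j < p) h.[kappa *+ j])%:P.
Proof.
move=> sh; set S := \sum_(j < p) _.
have Sx x : S.[x] = \sum_(j < p) h.[x + kappa *+ j].
  by rewrite horner_sum; apply: eq_bigr => j _; rewrite horner_comp !hornerE.
have Sinv x : S.[x + kappa] = S.[x].
  rewrite !Sx -(big_mkord xpredT (fun j => h.[x + kappa + kappa *+ j])).
  rewrite -(big_mkord xpredT (fun j => h.[x + kappa *+ j])).
  case: p p_gt0 pchar => // m _ mchar; rewrite big_nat_recr //= big_nat_recl //=.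
  rewrite -addrA -mulrS (mulrn_pchar mchar) mulr0n addr0 addrC; congr (_ + _).
  by apply: eq_bigr => j _; rewrite -addrA -mulrS.
have S0 (i : 'I_p) : S.[kappa *+ i] = S.[0].
  by elim: (val i) => [|m IH]; rewrite ?mulr0n // mulrSr Sinv.
have sS : (size S <= p)%N.
  apply: leq_trans (size_sum _ _ _) _; apply/bigmax_leqP => j _.
  by rewrite -[(kappa *+ j)%:P]opprK -polyCN size_comp_poly2 ?size_XsubC.
have -> : \sum_(j < p) h.[kappa *+ j] = S.[0].
  by rewrite Sx; apply: eq_bigr => j _; rewrite add0r.
apply/eqP; rewrite -subr_eq0; apply: contraTT (sS) => nz; rewrite -ltnNge.
have inj : injective (fun i : 'I_p => kappa *+ i).
  by move=> i j e; apply: val_inj; apply: (kappa_mulrn_inj pchar kp kappak) => //; exact: ltn_ord.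
have : \prod_(i < p) ('X - (kappa *+ i)%:P) %| S - (S.[0])%:P.
  by apply: prod_XsubC_dvdp => // i; rewrite hornerD hornerN hornerC S0 subrr.
move/(dvdp_leq nz); rewrite size_prod_XsubC_fin card_ord => h1.
apply: leq_trans h1 _; apply: leq_trans (size_polyD _ _) _.
rewrite size_polyN geq_max leqnn (leq_trans (size_polyC_leq1 _)) // lt0n size_poly_eq0.
by apply: contraNneq nz => ->; rewrite horner0 subrr.
Qed.

Lemma sum_translates_alg (h : {poly K}) (x : P) : (size h <= p)%N ->
  \sum_(j < p) horner_alg (x + (kappa *+ j)%:MP) h = (\sum_(j < p) h.[kappa *+ j])%:MP.
Proof.
move=> sh; have := congr1 (horner_alg x) (sum_translates_const sh).
rewrite horner_algC alg_mpolyC rmorph_sum => <-; apply: eq_bigr => j _.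
rewrite /= /horner_alg /horner_morph map_comp_poly horner_comp rmorphD /= map_polyX map_polyC.
by rewrite !hornerE /= alg_mpolyC.
Qed.

Definition AS_poly (q : P) : Prop := exists w : P, q = w \mPo AS.

Lemma AS_polyD q r : AS_poly q -> AS_poly r -> AS_poly (q + r).
Proof. by move=> [w ->] [w' ->]; exists (w + w'); rewrite comp_mpolyD. Qed.

Lemma AS_polyM q r : AS_poly q -> AS_poly r -> AS_poly (q * r).
Proof. by move=> [w ->] [w' ->]; exists (w * w'); rewrite rmorphM. Qed.

Lemma AS_polyC c : AS_poly c%:MP.
Proof. by exists c%:MP; rewrite comp_mpolyC. Qed.

Lemma AS_polyX i : AS_poly ('X_i ^+ p - 'X_i).
Proof. by exists 'X_i; rewrite comp_mpolyXU -tnth_nth tnth_mktuple. Qed.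

(** Each y = X_i + j [kappa] satisfies y^p = (X_i^p - X_i) + y, because Frobenius fixes [kappa].
    This lowers the exponent until m < p, where the sum is constant. *)
Lemma AS_poly_sum_pow i m : AS_poly (\sum_(j < p) ('X_i + (kappa *+ j)%:MP) ^+ m).
Proof.
elim/ltn_ind: m => m IH; have [mp|pm] := ltnP m p.
  have := @sum_translates_alg 'X^m 'X_i; rewrite size_polyXn => /(_ mp) e.
  rewrite (eq_bigr (fun j : 'I_p => horner_alg ('X_i + (kappa *+ j)%:MP) ('X^m))) => [|j _].
    by rewrite e; exact: AS_polyC.
  by rewrite rmorphXn /= horner_algX.
have p_gt1 := prime_gt1 (pcharf_prime pchar).
have charP : p \in [pchar P] by rewrite (pchar_lalg P).
rewrite (eq_bigr (fun j : 'I_p => ('X_i ^+ p - 'X_i) * ('X_i + (kappa *+ j)%:MP) ^+ (m - p) +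
    ('X_i + (kappa *+ j)%:MP) ^+ (m - p).+1)) => [|j _]; last first.
  rewrite -{1}(subnK pm) exprD -(pFrobenius_autE charP) rmorphD /= !pFrobenius_autE.
  rewrite -(rmorphXn (@mpolyC n K)) /= -(pFrobenius_autE pchar) pFrobenius_autMn pFrobenius_autE.
  by rewrite (kappa_expp pchar kp kappak) exprS -mulrDl addrA subrK mulrC.
rewrite big_split -mulr_sumr /=; apply: AS_polyD; last by apply: IH; lia.
by apply: AS_polyM; [exact: AS_polyX | apply: IH; lia].
Qed.

Definition Fp_translation (e : {ffun 'I_n -> 'I_p}) : n.-tuple P :=
  translation (fun i => - (kappa *+ e i)).

Lemma tnth_Fp_translation e i : tnth (Fp_translation e) i = 'X_i + (kappa *+ e i)%:MP.
Proof. by rewrite tnth_mktuple mpolyCN opprK. Qed.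

(** On a monomial the sum over F_p^n factors into one power sum for each variable. *)
Lemma AS_poly_trace (u : P) : AS_poly (\sum_e (u \mPo Fp_translation e)).
Proof.
rewrite (eq_bigr (fun e : {ffun 'I_n -> 'I_p} => \sum_(m <- msupp u)
    u@_m *: \prod_i ('X_i + (kappa *+ e i)%:MP) ^+ m i)) => [|e _]; last first.
  rewrite comp_mpolyE; apply: eq_bigr => m _; congr (_ *: _).
  by apply: eq_bigr => i _; rewrite tnth_Fp_translation.
rewrite exchange_big /=; elim/big_ind: _ => [||m _].
- by rewrite -mpolyC0; exact: AS_polyC.
- exact: AS_polyD.
rewrite -scaler_sumr -mul_mpolyC; apply: AS_polyM; first exact: AS_polyC.
rewrite -(bigA_distr_bigA (fun i j => ('X_i + (kappa *+ (j : 'I_p))%:MP) ^+ m i)).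
elim/big_ind: _ => [||i _]; last exact: AS_poly_sum_pow.
- by rewrite -mpolyC1; exact: AS_polyC.
- exact: AS_polyM.
Qed.

Lemma trace_one : exists th : P, \sum_e (th \mPo Fp_translation e) = 1.
Proof.
(* The indicator function of the origin on F_p^n. Its trace is a product of constants, one for each
   variable, computed at 0 by [kappa_fermat]. *)
exists (\prod_i (1 - 'X_i ^+ p.-1)).
rewrite (eq_bigr (fun e : {ffun 'I_n -> 'I_p} =>
    \prod_i (1 - ('X_i + (kappa *+ e i)%:MP) ^+ p.-1))) => [|e _]; last first.
  rewrite rmorph_prod; apply: eq_bigr => i _.
  by rewrite /= rmorphB rmorph1 rmorphXn /= comp_mpolyXU -tnth_nth tnth_Fp_translation.
rewrite -(bigA_distr_bigA (fun i j => 1 - ('X_i + (kappa *+ (j : 'I_p))%:MP) ^+ p.-1 : P)).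
rewrite big1 // => i _.
have sh : (size (1 - 'X^(p.-1) : {poly K})%R <= p)%N.
  by rewrite (leq_trans (size_polyD _ _)) // geq_max size_polyN size_polyXn size_poly1 prednK ?leqnn p_gt0.
have := sum_translates_alg 'X_i sh.
rewrite (eq_bigr (fun j : 'I_p => 1 - ('X_i + (kappa *+ j)%:MP) ^+ p.-1)) => [->|j _]; last first.
  by rewrite rmorphB rmorph1 rmorphXn /= horner_algX.
rewrite (eq_bigr (fun j : 'I_p => (j == 0 :> nat)%:R)) => [|j _]; last first.
  by rewrite -(kappa_fermat pchar kp kappak (ltn_ord j)) !hornerE.
rewrite -(big_mkord xpredT (fun j => (j == 0%N)%:R)) big_ltn //= big_nat big1 ?addr0 ?mpolyC1 //.
by case.
Qed.

Lemma invariant_translation (q : P) e :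
  (forall a, q \mPo shift_tuple a kappa = q) -> q \mPo Fp_translation e = q.
Proof.
move=> qinv.
have one a m : q \mPo translation (fun i => if i == a then kappa *+ m else 0) = q.
  elim: m => [|m IH]; first by rewrite translation0 // => i; case: ifP.
  rewrite -[RHS]IH -{2}(qinv a) shift_tupleE translationD; congr (_ \mPo _).
  by apply: eq_translation => i; case: ifP; rewrite ?addr0 // mulrS.
(* Shifts subtract [kappa] while [Fp_translation] adds its multiples, hence the complement to p. *)
pose e' i := (p - e i)%N.
have many (r : seq 'I_n) : uniq r ->
    q \mPo translation (fun i => if i \in r then kappa *+ e' i else 0) = q.
  elim: r => [|a r IH] /=; first by rewrite translation0.
  case/andP=> ar ur; rewrite -[RHS](IH ur) -{2}(one a (e' a)) translationD; congr (_ \mPo _).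
  apply: eq_translation => i; rewrite inE; case: eqP => [->|_] /=; last by rewrite add0r.
  by rewrite (negPf ar) addr0.
rewrite -[RHS](many _ (enum_uniq 'I_n)); congr (_ \mPo _); apply: eq_translation => i.
by rewrite mem_enum /= /e' mulrnBr ?(ltnW (ltn_ord _)) // (mulrn_pchar pchar) sub0r.
Qed.

(** Averaging over the p^n translations is impossible in characteristic p. An element [th] of trace
    1 replaces it: q is the trace of [th * q]. *)
Lemma AS_poly_invariant (q : P) :
  (forall a, q \mPo shift_tuple a kappa = q) -> AS_poly q.
Proof.
move=> qinv; have [th th1] := trace_one.
have -> : q = \sum_e ((th * q) \mPo Fp_translation e); last exact: AS_poly_trace.
rewrite -[LHS]mul1r -th1 mulr_suml; apply: eq_bigr => e _.
by rewrite (rmorphM (comp_mpoly _)) /= (invariant_translation _ qinv).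
Qed.

Definition norm (v : P) : P := \prod_e (v \mPo Fp_translation e).

Lemma norm_neq0 v : v != 0 -> norm v != 0.
Proof.
move=> v0; rewrite prodf_seq_neq0; apply/allP => e _ /=.
apply: contra_neq v0 => ve.
have := congr1 (comp_mpoly (translation (fun i => kappa *+ e i))) ve.
rewrite comp_mpoly0 translationD translation0 // => i.
by rewrite addNr.
Qed.

Lemma norm_dvd v : exists w, norm v = v * w.
Proof.
exists (\prod_(e | e != [ffun=> Ordinal p_gt0]) (v \mPo Fp_translation e)).
rewrite /norm (bigD1 [ffun=> Ordinal p_gt0]) //=; congr (_ * _).
by apply: translation0 => i; rewrite ffunE mulr0n oppr0.
Qed.

Lemma norm_invariant v a : norm v \mPo shift_tuple a kappa = norm v.
Proof.
(* Subtracting [kappa] is adding p - 1 times [kappa], so the shift permutes the factors of the norm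
   by e_a -> e_a + p - 1 mod p. *)
pose s (i : 'I_n) := if i == a then p.-1 else 0%N.
pose h (e : {ffun 'I_n -> 'I_p}) : {ffun 'I_n -> 'I_p} :=
  [ffun i => Ordinal (ltn_pmod (e i + s i) p_gt0)].
have h_inj : injective h.
  move=> e e' /ffunP ee'; apply/ffunP => i; have := ee' i; rewrite !ffunE => /(congr1 val) /=.
  by move/eqP; rewrite eqn_modDr !modn_small // => /eqP /val_inj.
rewrite [RHS](reindex_inj h_inj) rmorph_prod; apply: eq_bigr => e _ /=.
rewrite shift_tupleE /Fp_translation translationD; congr (_ \mPo _).
apply: eq_translation => i; rewrite ffunE /= (kappa_mulrn_mod kappa pchar) mulrnDr opprD /s.
congr (_ + _); case: ifP => _; last by rewrite mulr0n oppr0.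
by apply/eqP; rewrite -subr_eq0 opprK -mulrS prednK // (mulrn_pchar pchar).
Qed.

(** The fraction is expanded to have the invariant denominator [norm v]; its numerator is then
    invariant as well, and [AS_poly_invariant] applies to both. *)
Lemma rational_in_invariant (c : ratfun K n) :
  (forall a, shift a kappa c = c) -> rational_in AS c.
Proof.
move=> cinv; have [u [v [v0 cE]]] := ratfunP c.
have [w wE] := norm_dvd v; have N0 := norm_neq0 v0.
have w0 : w != 0 by apply: contraNneq N0 => w0; rewrite wE w0 mulr0.
have {}cE : c = (u * w)%:F / (norm v)%:F.
  rewrite cE wE !rmorphM /= -mulf_div divff ?mulr1 // tofrac_eq0 //.
have [N NE] : AS_poly (norm v) by apply: AS_poly_invariant => a; exact: norm_invariant.
have [U UE] : AS_poly (u * w).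
  apply: AS_poly_invariant => a; apply/eqP; rewrite -tofrac_eq -shift_tofrac.
  have -> : (u * w)%:F = c * (norm v)%:F by rewrite cE divfK // tofrac_eq0.
  have -> : shift a kappa (c * (norm v)%:F) = shift a kappa c * shift a kappa (norm v)%:F.
    exact: rmorphM.
  by rewrite cinv shift_tofrac norm_invariant.
by exists U, N; rewrite -NE -UE.
Qed.

End Invariants.

(** * p-hypergeometric solutions *)

(** The factors t - z_j taken out of Phi are the common denominator of the eta_b, so Q_b is
    [psi_prod] times the numerator of eta_b. *)
Lemma poch_quotE_numer (E : fieldType) (k n : nat) (kappa : E) (z : 'I_n -> E) b :
  poch_quot (fun j => 'X - (z j)%:P) kappa%:P k.+1 b =
  psi_prod k kappa z * numer z (enum 'I_n) b.
Proof.
rewrite numer_sorted ?enum_ord_sorted ?mem_enum // big_enum -big_split /=.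
apply: eq_bigr => j _; have -> : 'X - (z j)%:P - kappa%:P = 'X - (z j + kappa)%:P.
  by rewrite polyCD opprD addrA.
rewrite !poch_pprod; case: ifP => _; first by rewrite mulrC.
by case: ifP => _; [rewrite mulr1 | rewrite pprod_recl mulrC].
Qed.

(** The expansion that defines the Q^i has an unspecified length N. Since coefficients in the
    Pochhammer basis are unique, any bound M on the size can replace it. *)
Lemma poch_expansion_size (A : comNzRingType) (kappa : A) (q : {poly A}) M N (C : nat -> A) :
  (size q <= M)%N -> (forall i, (N <= i)%N -> C i = 0) ->
  q = \sum_(i < N) (C i)%:P * poch 'X kappa%:P i ->
  q = \sum_(i < M) (C i)%:P * poch 'X kappa%:P i.
Proof.
move=> sq C0 qE; have [c cE] := poch_basis kappa sq.
rewrite {1}cE; apply: eq_bigr => i _; congr (_%:P * _).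
have c'0 j : (M <= j)%N -> (if (j < M)%N then c j else 0) = 0 by rewrite leqNgt => /negPf ->.
rewrite -(poch_inj c'0 C0 (kappa := kappa)) ?ltn_ord // -qE {1}cE.
by apply: eq_bigr => j _; rewrite ltn_ord.
Qed.

Lemma zvar_generic (K : fieldType) (n : nat) (kappa : K) (i j : 'I_n) m :
  i != j -> zvar K i + (kappa%:MP)%:F *+ m != zvar K j.
Proof.
move=> ij; rewrite /zvar -rmorphMn -rmorphD tofrac_eq; apply/eqP => e.
(* At the origin the equation reads m [kappa] = 0, at the i-th unit vector 1 + m [kappa] = 0. *)
have := congr1 (meval (fun=> 0)) e; have := congr1 (meval (fun l => (l == i)%:R)) e.
rewrite !mevalD !mevalMn !mevalC !mevalXU eqxx (negPf (_ : j != i)) 1?eq_sym // add0r => e1 e2.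
by move/eqP: e1; rewrite e2 addr0 oner_eq0.
Qed.

(** Carries the identity from the fractions of K[z][t] to polynomials in t over K(z), cut at the
    degree bound that [qKZ_combination] expects. *)
Lemma Qcoef_expansion (K : fieldType) (n k : nat) (kappa : K) b :
  psi_prod k (kappa%:MP)%:F (zvar K (n := n)) * numer (zvar K (n := n)) (enum 'I_n) b =
  \sum_(i < n * k.+1) (Qcoef n kappa k.+1 i b 0)%:F *: poch 'X ((kappa%:MP)%:F)%:P i.
Proof.
have [N [c0 cE]] := QcoefP n kappa (ltn0Sn k).
pose x j : {poly {mpoly K[n]}} := 'X - ('X_j : {mpoly K[n]})%:P.
have qE : poch_quot x (kappa%:MP)%:P k.+1 b =
    \sum_(i < N) (Qcoef n kappa k.+1 i b 0)%:P * poch 'X (kappa%:MP)%:P i.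
  apply/eqP; rewrite -tofrac_eq rmorph_sum /=; apply/eqP.
  rewrite (eq_bigr (fun i : 'I_N => ((Qcoef n kappa k.+1 i b 0)%:P)%:F *
    poch (tz_t K n) (tz_kappa n kappa) i)) => [|i _]; last by rewrite rmorphM rmorph_poch.
  rewrite -cE /Qfun /Phi /eta (poch_quotE _ _ (ltn0Sn k) (@tz_neq0 K n)) rmorph_poch_quot.
  by apply: eq_bigr => j _; rewrite /= !rmorphB.
have := congr1 (map_poly (@FracField.tofrac _)) qE; rewrite rmorph_poch_quot /= map_polyC /=.
have -> : poch_quot (map_poly (@FracField.tofrac {mpoly K[n]}) \o x) ((kappa%:MP)%:F)%:P k.+1 b =
    poch_quot (fun j => 'X - (zvar K j)%:P) ((kappa%:MP)%:F)%:P k.+1 b.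
  by apply: eq_bigr => j _; rewrite /= map_polyXsubC.
rewrite poch_quotE_numer rmorph_sum /= => PE.
rewrite (poch_expansion_size (kappa := (kappa%:MP)%:F) (M := (n * k.+1)%N) (N := N)
  (C := fun i => (Qcoef n kappa k.+1 i b 0)%:F) (q := psi_prod _ _ _ * _)).
- by apply: eq_bigr => i _; rewrite mul_polyC.
- apply: leq_trans (size_polyMleq _ _) _; rewrite size_psi_prod /= mulnS addnC leq_add2r.
  by rewrite (leq_trans (size_numer _ _ _)) // -cardE card_ord.
- by move=> i /c0 ->; rewrite mxE rmorph0.
rewrite PE; apply: eq_bigr => i _.
by rewrite rmorphM /= map_polyC /= (rmorph_poch (map_poly _)) /= map_polyX map_polyC.
Qed.

Theorem theorem1p2 (K : fieldType) (p n k : nat) (kappa : K)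
    (f : 'cV[ratfun K n]_n) :
  p \in [pchar K] -> (1 < n)%N -> (n < p)%N ->
  prime_subfield kappa -> kappa != 0 ->
  (0 < k < p)%N -> kappa * k%:R = -1 ->
  (0 < dnum p n k < n - 1)%N ->
  V_valued f -> qKZ_solution kappa f ->
  exists c : nat -> ratfun K n,
    (forall l, (1 <= l <= dnum p n k)%N ->
       rational_in (artin_schreier_tuple K n p) (c l)) /\
    f = \sum_(1 <= l < (dnum p n k).+1) c l *: Qsol n kappa k p l.
Proof.
move=> pchar _ _ _ _; case: k => [|k] // /andP[_ kp]; rewrite mulr_natr => kappak.
rewrite /dnum mulnC => /andP[d_gt0 _] fV fqKZ.
have p_gt0 := prime_gt0 (pcharf_prime pchar).
have pnk : (p <= n * k.+1)%N by move: d_gt0; rewrite divn_gt0.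
have pcharF : p \in [pchar ratfun K n].
  by apply: (rmorph_pchar (@FracField.tofrac _)); apply: (rmorph_pchar (@mpolyC n K)).
pose kF : ratfun K n := (kappa%:MP)%:F.
have kFk : kF *+ k.+1 = -1 by rewrite -!rmorphMn kappak !rmorphN !rmorph1.
pose g : {ffun 'I_n -> (ratfun K n)^o} := [ffun b => f b 0].
have embedE (h : 'cV[ratfun K n]_n) : embed h = embedf [ffun b => h b 0].
  by congr embed; apply/colP => b; rewrite mxE ffunE.
have g_V : \sum_b g b = 0 by rewrite -[RHS]fV; apply: eq_bigr => b _; rewrite ffunE.
have g_qKZ a b : shift a kappa (g b) =
    foldr (fun j => Rvec a j (zvar K a - zvar K j - (if (j < a)%N then kF else 0)))
      g (Kindices a) b.
  have := fqKZ a; rewrite !embedE Kop_embedf => /embedf_inj/ffunP/(_ b).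
  by rewrite !ffunE mxE => ->.
(* [sigma] is the shift by [kappa] and [tau] the inverse shift, whose p-th iterate is the identity
   as p [kappa] = 0. *)
have [c [cinv cE]] := qKZ_combination pcharF kp kFk (@zvar_generic K n kappa) g_V
  (sigma := fun a => shift a kappa) (tau := fun a => shift a (- kappa))
  (fun a => shiftK a kappa)
  (fun a x => iter_shift a x (mulrn_pchar pchar (- kappa)))
  (fun a => shift_const a kappa kappa) (fun a j => shift_zvar a kappa j)
  g_qKZ pnk (C := fun i b => (Qcoef n kappa k.+1 i b 0)%:F) (@Qcoef_expansion K n k kappa).
exists c; split=> [l _|].
  by apply: (rational_in_invariant pchar kp kappak) => a; exact: cinv.
apply/colP => b; have := cE b; rewrite ffunE => ->.
by rewrite summxE; apply: eq_bigr => l _; rewrite !mxE.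
Qed.
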